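(* For any fixed $k>4$, the separator realizability problem for $\mathrm{FO}(k)$ is $\mathsf{EXPTIME}$-hard: the problem of deciding, given finite sets $\mathit{Pos},\mathit{Neg}$ of finite $\tau$-structures and a regular tree grammar $G$ over $\Sigma_{\mathrm{FO}(k)}$, whether there exists a sentence $\varphi\in L(G)$ with $A\models\varphi$ for all $A\in\mathit{Pos}$ and $B\not\models\varphi$ for all $B\in\mathit{Neg}$.
   Context: A signature $\tau$ is a finite set of relation, function and constant symbols with arities; structures are finite. $\mathrm{FO}$ is first-order logic with if-then-else terms: formulas $\varphi::=R(\bar t)\mid\varphi\vee\varphi\mid\varphi\wedge\varphi\mid\neg\varphi\mid\exists x.\varphi\mid\forall x.\varphi$, terms $t::=x\mid c\mid f(\bar t)\mid\mathsf{ite}(\varphi,t,t')$. $\mathrm{FO}(k)$ is the fragment using only the $k$ variables $V=\{x_1,\dots,x_k\}$ (reusable). Formulas are trees over the ranked alphabet $\Sigma_{\mathrm{FO}(k)}=\{R^{\mathrm{ar}(R)},f^{\mathrm{ar}(f)}:R,f\in\tau\}\cup\{\mathsf{ite}^3,\wedge^2,\vee^2,\neg^1\}\cup\{\forall x^1,\exists x^1,x^0:x\in V\}$. A regular tree grammar $G=\langle N,\Sigma,S,P\rangle$ has nonterminals $N$, axiom $S$ and rules $B\to t$ ($t$ a tree over $\Sigma\cup N$); $L(G)$ is the set of trees over $\Sigma$ derivable from $S$. *)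

(* Defs.v *)
From Stdlib Require List Relation_Operators FunctionalExtensionality.
From mathcomp Require Import all_boot.

Set Implicit Arguments.
Unset Strict Implicit.
Unset Printing Implicit Defensive.

(** * Deterministic multi-tape Turing machines over binary inputs *)

Definition word := seq bool.
Definition language := word -> Prop.

Inductive move := MoveL | MoveN | MoveR.

(* [None] is the blank; [extra] are the working symbols besides 0 and 1. *)
Definition cell (extra : finType) : Type := option (bool + extra).

Definition bit_cell (extra : finType) (b : bool) : cell extra := Some (inl b).

(* Tapes are two-way infinite: [left] lists the cells to the left of the head,
   nearest first, and all cells that are not listed are blank. *)
Record tape (extra : finType) := Tape {
  left : seq (cell extra);
  scanned : cell extra;
  right : seq (cell extra) }.

Definition act (extra : finType) (a : cell extra * move) (t : tape extra) :
    tape extra :=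
  match a.2 with
  | MoveL => Tape (behead (left t)) (head None (left t)) (a.1 :: right t)
  | MoveN => Tape (left t) a.1 (right t)
  | MoveR => Tape (a.1 :: left t) (head None (right t)) (behead (right t))
  end.

(* The machine has [extra_tapes.+1] tapes and halts where [delta] is [None]. *)
Record TM := MkTM {
  state : finType;
  extra : finType;
  extra_tapes : nat;
  start_state : state;
  accept : pred state;
  delta : state -> (extra_tapes.+1).-tuple (cell extra) ->
          option (state * (extra_tapes.+1).-tuple (cell extra * move)) }.

Definition config (M : TM) : Type :=
  (state M * ((extra_tapes M).+1).-tuple (tape (extra M)))%type.

Definition step (M : TM) (c : config M) : option (config M) :=
  if delta c.1 (map_tuple (@scanned _) c.2) is Some (q, a)
  then Some (q, [tuple act (tnth a i) (tnth c.2 i) | i < (extra_tapes M).+1])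
  else None.

Definition halted (M : TM) (c : config M) : bool := ~~ step c.

(* Halted configurations are kept, so that [halted (run n c)] says that the
   machine halts within [n] steps from [c]. *)
Definition run (M : TM) (n : nat) (c : config M) : config M :=
  iter n (fun c' => odflt c' (step c')) c.

Definition word_tape (extra : finType) (w : word) : tape extra :=
  let s := map (@bit_cell extra) w in Tape [::] (head None s) (behead s).

Definition init (M : TM) (w : word) : config M :=
  (start_state M,
   [tuple word_tape (extra M) (if i == ord0 then w else [::])
     | i < (extra_tapes M).+1]).

Fixpoint bit_prefix (extra : finType) (s : seq (cell extra)) : word :=
  if s is Some (inl b) :: s' then b :: bit_prefix s' else [::].

(* The output is the longest bit string that starts at the head of the last
   tape. *)
Definition output (M : TM) (c : config M) : word :=
  let t := tnth c.2 ord_max in bit_prefix (scanned t :: right t).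

Definition decides_in_time (M : TM) (T : nat -> nat) (L : language) : Prop :=
  forall w, let c := run (T (size w)) (init M w) in
    halted c /\ (accept c.1 <-> L w).

Definition computes_in_time (M : TM) (T : nat -> nat) (f : word -> word) :
    Prop :=
  forall w, let c := run (T (size w)) (init M w) in
    halted c /\ output c = f w.

Definition EXPTIME (L : language) : Prop :=
  exists (M : TM) (c d : nat),
    decides_in_time M (fun n => 2 ^ (c * n ^ d + c)) L.

Definition polytime (f : word -> word) : Prop :=
  exists (M : TM) (c d : nat), computes_in_time M (fun n => c * n ^ d + c) f.

Definition poly_reducible (L K : language) : Prop :=
  exists f : word -> word, polytime f /\ forall w, L w <-> K (f w).

Definition EXPTIME_hard (K : language) : Prop :=
  forall L : language, EXPTIME L -> poly_reducible L K.

(** * Regular tree grammars *)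

Section Trees.
Variables (S : Type) (rank : S -> nat).

(* Trees over the ranked alphabet [S] and the nonterminals [N]. *)
Inductive tree (N : Type) : Type :=
| NT of N
| Node (s : S) of (tree N ^ rank s)%type.

Fixpoint terminal (N : Type) (t : tree N) : bool :=
  match t with
  | NT _ => false
  | Node s ts => [forall i, terminal (ts i)]
  end.

Record grammar := Grammar {
  nnt : nat;
  axiom : 'I_nnt;
  rules : seq ('I_nnt * tree 'I_nnt) }.

Inductive rewrites (G : grammar) : tree 'I_(nnt G) -> tree 'I_(nnt G) -> Prop :=
| rewrites_root B t : List.In (B, t) (rules G) -> rewrites (NT B) t
| rewrites_child s (ts : (tree 'I_(nnt G) ^ rank s)%type) i t :
    rewrites (ts i) t ->
    rewrites (Node ts) (Node [ffun j => if j == i then t else ts j]).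

Definition in_lang (G : grammar) (t : tree 'I_(nnt G)) : Prop :=
  terminal t /\ Relation_Operators.clos_refl_trans_1n _ (@rewrites G) (NT (axiom G)) t.

End Trees.

(** * First-order logic with [k] variables and if-then-else terms *)

(* Relation and function symbols are the positions in the lists of arities;
   constant symbols are the function symbols of arity 0. *)
Record signature := Signature { rel_ars : seq nat; fun_ars : seq nat }.

Definition rsym (tau : signature) := 'I_(size (rel_ars tau)).
Definition fsym (tau : signature) := 'I_(size (fun_ars tau)).
Definition rar (tau : signature) (r : rsym tau) : nat := nth 0 (rel_ars tau) r.
Definition far (tau : signature) (f : fsym tau) : nat := nth 0 (fun_ars tau) f.

(* Domains are nonempty, and every finite structure is taken up to isomorphism
   to have the domain {0, ..., n}. *)
Record structure (tau : signature) := Structure {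
  dom_pred : nat;
  rel_int : forall r : rsym tau, {ffun (rar r).-tuple 'I_dom_pred.+1 -> bool};
  fun_int : forall f : fsym tau,
    {ffun (far f).-tuple 'I_dom_pred.+1 -> 'I_dom_pred.+1} }.

Definition dom (tau : signature) (A : structure tau) := 'I_(dom_pred A).+1.

Section FO.
Variables (k : nat) (tau : signature).

Inductive term : Type :=
| TVar of 'I_k
| TFun (f : fsym tau) of (term ^ far f)%type
| TIte of formula & term & term
with formula : Type :=
| FRel (r : rsym tau) of (term ^ rar r)%type
| FOr of formula & formula
| FAnd of formula & formula
| FNot of formula
| FEx of 'I_k & formula
| FAll of 'I_k & formula.

Fixpoint term_fv (t : term) : {set 'I_k} :=
  match t with
  | TVar x => [set x]
  | TFun f ts => \bigcup_i term_fv (ts i)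
  | TIte p t1 t2 => fv p :|: term_fv t1 :|: term_fv t2
  end
with fv (p : formula) : {set 'I_k} :=
  match p with
  | FRel r ts => \bigcup_i term_fv (ts i)
  | FOr p1 p2 | FAnd p1 p2 => fv p1 :|: fv p2
  | FNot p1 => fv p1
  | FEx x p1 | FAll x p1 => fv p1 :\ x
  end.

Definition sentence (p : formula) : Prop := fv p = set0.

Definition valuation (A : structure tau) := {ffun 'I_k -> dom A}.

Definition update (A : structure tau) (v : valuation A) (x : 'I_k) (a : dom A) :
    valuation A :=
  [ffun y => if y == x then a else v y].

Fixpoint eval (A : structure tau) (v : valuation A) (t : term) : dom A :=
  match t with
  | TVar x => v x
  | TFun f ts => fun_int A f [tuple eval v (ts i) | i < far f]
  | TIte p t1 t2 => if sat v p then eval v t1 else eval v t2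
  end
with sat (A : structure tau) (v : valuation A) (p : formula) : bool :=
  match p with
  | FRel r ts => rel_int A r [tuple eval v (ts i) | i < rar r]
  | FOr p1 p2 => sat v p1 || sat v p2
  | FAnd p1 p2 => sat v p1 && sat v p2
  | FNot p1 => ~~ sat v p1
  | FEx x p1 => [exists a : dom A, sat (update v x a) p1]
  | FAll x p1 => [forall a : dom A, sat (update v x a) p1]
  end.

(* Only used for sentences, for which the valuation is irrelevant. *)
Definition models (A : structure tau) (p : formula) : Prop :=
  forall v : valuation A, sat v p.

Inductive fo_sym : Type :=
| SRel of rsym tau
| SFun of fsym tau
| SIte | SAnd | SOr | SNot
| SAll of 'I_k
| SEx of 'I_k
| SVar of 'I_k.

Definition fo_rank (s : fo_sym) : nat :=
  match s with
  | SRel r => rar r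
  | SFun f => far f
  | SIte => 3
  | SAnd | SOr => 2
  | SNot | SAll _ | SEx _ => 1
  | SVar _ => 0
  end.

Definition fo_tree := tree fo_rank.
Definition fo_grammar := grammar fo_rank.

Fixpoint term_tree (N : Type) (t : term) : fo_tree N :=
  match t with
  | TVar x => @Node _ fo_rank N (SVar x) (finfun (tnth [tuple]))
  | TFun f ts => @Node _ fo_rank N (SFun f) [ffun i => term_tree N (ts i)]
  | TIte p t1 t2 =>
      @Node _ fo_rank N SIte (finfun
        (tnth [tuple formula_tree N p; term_tree N t1; term_tree N t2]))
  end
with formula_tree (N : Type) (p : formula) : fo_tree N :=
  match p with
  | FRel r ts => @Node _ fo_rank N (SRel r) [ffun i => term_tree N (ts i)]
  | FOr p1 p2 =>
      @Node _ fo_rank N SOr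
        (finfun (tnth [tuple formula_tree N p1; formula_tree N p2]))
  | FAnd p1 p2 =>
      @Node _ fo_rank N SAnd
        (finfun (tnth [tuple formula_tree N p1; formula_tree N p2]))
  | FNot p1 =>
      @Node _ fo_rank N SNot (finfun (tnth [tuple formula_tree N p1]))
  | FEx x p1 =>
      @Node _ fo_rank N (SEx x) (finfun (tnth [tuple formula_tree N p1]))
  | FAll x p1 =>
      @Node _ fo_rank N (SAll x) (finfun (tnth [tuple formula_tree N p1]))
  end.

End FO.

(** * The separator realizability problem *)

Record instance (k : nat) := Instance {
  sig : signature;
  Pos : seq (structure sig);
  Neg : seq (structure sig);
  gram : fo_grammar k sig }.

Definition realizable (k : nat) (I : instance k) : Prop :=
  exists p : formula k (sig I),
    [/\ sentence p,
        in_lang (formula_tree 'I_(nnt (gram I)) p),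
        forall A, List.In A (Pos I) -> models A p &
        forall B, List.In B (Neg I) -> ~ models B p].

(* Instances are coded as bit strings: numbers are in unary, structures are
   given by the full tables of their relations and functions, and trees are
   written in prefix order. *)

Definition code_nat (n : nat) : word := nseq n true ++ [:: false].

Definition code_bool (b : bool) : word := [:: b].

Definition code_seq (T : Type) (e : T -> word) (s : seq T) : word :=
  flatten [seq true :: e x | x <- s] ++ [:: false].

Definition code_signature (tau : signature) : word :=
  code_seq code_nat (rel_ars tau) ++ code_seq code_nat (fun_ars tau).

(* Tables list the values on all tuples in the order of [enum], which is
   lexicographic. *)
Definition code_structure (tau : signature) (A : structure tau) : word :=
  code_nat (dom_pred A) ++
  flatten [seq code_seq code_bool (codom (rel_int A r)) | r : rsym tau] ++
  flatten [seq code_seq (fun a : dom A => code_nat a) (codom (fun_int A f))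
          | f : fsym tau].

Definition code_sym (k : nat) (tau : signature) (s : fo_sym k tau) : word :=
  match s with
  | SRel r => code_nat 1 ++ code_nat r
  | SFun f => code_nat 2 ++ code_nat f
  | SIte => code_nat 3
  | SAnd => code_nat 4
  | SOr => code_nat 5
  | SNot => code_nat 6
  | SAll x => code_nat 7 ++ code_nat x
  | SEx x => code_nat 8 ++ code_nat x
  | SVar x => code_nat 9 ++ code_nat x
  end.

Fixpoint code_tree (k : nat) (tau : signature) (n : nat)
    (t : fo_tree k tau 'I_n) : word :=
  match t with
  | NT B => code_nat 0 ++ code_nat B
  | Node s ts => code_sym s ++ flatten [seq code_tree (ts i) | i : 'I_(fo_rank s)]
  end.

Definition code_grammar (k : nat) (tau : signature) (G : fo_grammar k tau) :
    word :=
  code_nat (nnt G) ++ code_nat (axiom G) ++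
  code_seq (fun r : 'I_(nnt G) * fo_tree k tau 'I_(nnt G) =>
              code_nat r.1 ++ code_tree r.2) (rules G).

Definition code_instance (k : nat) (I : instance k) : word :=
  code_signature (sig I) ++
  code_seq (@code_structure (sig I)) (Pos I) ++
  code_seq (@code_structure (sig I)) (Neg I) ++
  code_grammar (gram I).

(* The coding is injective: every code below is prefix-free. *)

Definition prefix_code (T : Type) (e : T -> word) : Prop :=
  forall x y u v, e x ++ u = e y ++ v -> x = y /\ u = v.

Lemma code_nat_prefix : prefix_code code_nat.
Proof.
elim=> [|m IH] [|n] u v //=; first by case.
by case=> /IH[-> ->].
Qed.

Lemma code_bool_prefix : prefix_code code_bool.
Proof. by move=> x y u v [-> ->]. Qed.

Lemma code_ord_prefix n : prefix_code (fun i : 'I_n => code_nat i).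
Proof. by move=> x y u v /code_nat_prefix[/val_inj -> ->]. Qed.

Lemma code_seq_prefix T (e : T -> word) : prefix_code e -> prefix_code (code_seq e).
Proof.
move=> eP; elim=> [|x s IH] [|y t] u v; rewrite /code_seq /= => -[] //.
rewrite -!catA => /eP[->]; move=> E; by have [|-> ->] := IH t u v; rewrite /code_seq -?catA.
Qed.

Lemma code_fam_prefix (I : eqType) (e e' : I -> word) (P : I -> Prop) (s : seq I) u v :
    (forall i u v, e i ++ u = e' i ++ v -> P i /\ u = v) ->
    flatten [seq e i | i <- s] ++ u = flatten [seq e' i | i <- s] ++ v ->
  {in s, forall i, P i} /\ u = v.
Proof.
move=> eP; elim: s => [|i s IH] //=; rewrite -!catA => /eP[fg].
by move=> /IH[fgs ->]; split=> // j; rewrite inE => /predU1P[->|/fgs].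
Qed.

Lemma code_table_prefix (aT : finType) rT (e : rT -> word) :
  prefix_code e -> prefix_code (fun f : {ffun aT -> rT} => code_seq e (codom f)).
Proof.
move=> eP f g u v /(code_seq_prefix eP)[fg ->]; split=> //.
by apply/ffunP=> x; move/eq_in_map: fg; apply; rewrite mem_enum.
Qed.

Lemma code_structure_prefix tau : prefix_code (@code_structure tau).
Proof.
move=> [n R F] [n' R' F'] u v; rewrite /code_structure /= -?(catA (code_nat _)) -?(catA (flatten _)).
move=> /code_nat_prefix[En]; case: _ / En in R' F' *.
move=> /(code_fam_prefix (fun r => @code_table_prefix _ _ _ code_bool_prefix (R r) (R' r))).
move=> [ER] /(code_fam_prefix (fun f =>
  @code_table_prefix _ _ _ (@code_ord_prefix _) (F f) (F' f)))[EF ->].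
have ->: R = R'.
  apply: FunctionalExtensionality.functional_extensionality_dep => r.
  by apply: ER; rewrite mem_enum.
have -> // : F = F'.
apply: FunctionalExtensionality.functional_extensionality_dep => f.
by apply: EF; rewrite mem_enum.
Qed.

Lemma code_sym_prefix k tau : prefix_code (@code_sym k tau).
Proof.
by move=> [r|f|||||x|x|x] [r'|f'|||||x'|x'|x'] u v //= [] //;
  try (by move=> ->); move=> /code_ord_prefix[-> ->].
Qed.

Fixpoint code_tree_prefix k tau n (t : fo_tree k tau 'I_n) {struct t} :
  forall t' u v, code_tree t ++ u = code_tree t' ++ v -> t = t' /\ u = v.
Proof.
case: t => [B|s ts] [B'|s' ts'] u v /=; first 1 last.
- by case: s' ts' => [r|f|||||x|x|x].
- by case: s ts => [r|f|||||x|x|x].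
- rewrite -?(catA (code_sym _)) => /code_sym_prefix[Es]; case: _ / Es in ts' *.
  move=> /(code_fam_prefix (fun i => code_tree_prefix k tau n (ts i) (ts' i)))[Et ->].
  by split=> //; congr (Node _); apply/ffunP=> i; apply: Et; rewrite mem_enum.
by case=> /code_ord_prefix[-> ->].
Qed.

Lemma code_grammar_prefix k tau : prefix_code (@code_grammar k tau).
Proof.
move=> [n S P] [n' S' P'] u v; rewrite /code_grammar /= -?(catA (code_nat _)) -?(catA (code_nat _)).
move=> /code_nat_prefix[En]; case: _ / En in S' P' *.
move=> /code_ord_prefix[->] /code_seq_prefix[|-> ->] //.
move=> [B t] [B' t'] u' v' /=; rewrite -?(catA (code_nat _)).
by move=> /code_ord_prefix[-> /code_tree_prefix[-> ->]].
Qed.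

Lemma code_signature_prefix : prefix_code code_signature.
Proof.
move=> [r f] [r' f'] u v; rewrite /code_signature /= -?(catA (code_seq _ _)).
by move=> /(code_seq_prefix code_nat_prefix)[-> /(code_seq_prefix code_nat_prefix)[-> ->]].
Qed.

Lemma code_instance_inj k : injective (@code_instance k).
Proof.
move=> [tau P N G] [tau' P' N' G']; rewrite /code_instance /=.
move=> /code_signature_prefix[Et]; case: _ / Et in P' N' G' *.
move=> /(code_seq_prefix (@code_structure_prefix _))[->].
move=> /(code_seq_prefix (@code_structure_prefix _))[->].
by rewrite -[code_grammar G]cats0 -[code_grammar G']cats0 => /code_grammar_prefix[->].
Qed.

Definition separator_realizability (k : nat) : language :=
  fun w => exists I : instance k, w = code_instance I /\ realizable I.

(* Main.v *)
(* A ground term is a proof tree, and a structure of domain {0, 1, error} is a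
   deterministic bottom-up tree automaton evaluating it; the atom [R(t)] holds in
   every positive structure exactly when no automaton reaches the error state.
   The run of an exponential-time machine is described by facts "at time [t] the
   machine is in state [q] and scans [a]" and "at time [t] the cell at distance
   [r] on one side of head [j] contains [x]", where [t] and [r] have polynomially
   many bits.  The nonterminals of the grammar carry everything but the numbers
   [t] and [r]; each bit of [t] and of [r] is tracked by one automaton.
   A symbol "increment at position [j]" flips bits [0..j] from [01..1] to
   [10..0] and is an error on every other pattern, so that each automaton
   performs its share of the increment without seeing the other bits. *)
Require Import Defs.
From HB Require Import structures.
From mathcomp Require Import all_boot zify.
From Stdlib Require Import FunctionalExtensionality Relation_Operators.

Set Implicit Arguments.
Unset Strict Implicit.
Unset Printing Implicit Defensive.

(** * Structured programs for machines with four tapes *)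

(** The obstacle is that a domain of three elements cannot store a number with polynomially many
    bits, while the grammar can only keep polynomially many nonterminals. The term is therefore a
    common certificate: all automata read the same term, each checks it on its own bit, and
    acceptance by the whole of [Pos] is the conjunction of these checks. No negative structure is
    used. Where a carry stops depends on all lower bits, so the grammar guesses the position and the
    automata only refute wrong guesses.

    Cells are addressed by their distance from the head because a move then changes every distance
    by one: successor, predecessor and a test for zero suffice for [r]. The only comparison of two
    numbers is the equality of the times of combined facts, and equality is checked bit by bit. The
    simulated machine is deterministic, so each fact has a fixed truth value and proof trees cannot
    mix different runs.

    The code is in unary, and the instance is laid out so that its code is a fixed nest of loops
    over input positions and bit positions. *)

Notation bcell := (cell void).
Notation btape := (tape void).
Definition env := 'I_4 -> btape.

Definition upd (f : env) (i : 'I_4) (t : btape) : env :=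
  fun j => if j == i then t else f j.

(** One step acts on at most one tape, which keeps the combinators below simple. A program stops in
    a state without transition, and it is there that [mseq] and [mwhile] take over control. *)
Record mach := Mach {
  mstate : finType;
  mstart : mstate;
  mdelta : mstate -> ('I_4 -> bcell) ->
           option (mstate * option ('I_4 * (bcell * move))) }.

Definition mscan (f : env) : 'I_4 -> bcell := fun i => scanned (f i).

Definition perform (a : option ('I_4 * (bcell * move))) (f : env) : env :=
  if a is Some (i, b) then upd f i (act b (f i)) else f.

Fixpoint path (M : mach) n (s : mstate M) (f : env) (s' : mstate M) (f' : env) : Prop :=
  if n is n'.+1 then
    exists s1 a, mdelta s (mscan f) = Some (s1, a) /\ path n' s1 (perform a f) s' f'
  else s = s' /\ f = f'.

Definition runs (M : mach) (f f' : env) (b : nat) : Prop :=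
  exists n s, [/\ n <= b, path n (mstart M) f s f' & mdelta s (mscan f') = None].

Lemma runs_le M f f' b b' : b <= b' -> runs M f f' b -> runs M f f' b'.
Proof. by move=> le [n [s [nb ? ?]]]; exists n, s; split=> //; apply: leq_trans le. Qed.

Lemma path_cat M n1 n2 s1 f1 s2 f2 s3 f3 :
  path n1 s1 f1 s2 f2 -> path n2 s2 f2 s3 f3 -> @path M (n1 + n2) s1 f1 s3 f3.
Proof.
elim: n1 s1 f1 => [|n1 IH] s1 f1 /=; first by case=> -> ->.
by move=> [s [a [e p]]] q; exists s, a; split=> //; apply: IH.
Qed.

Lemma path_lift M M' (h : mstate M -> mstate M') n s f s' f' :
  (forall s sc s' a, mdelta s sc = Some (s', a) -> mdelta (h s) sc = Some (h s', a)) ->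
  path n s f s' f' -> path n (h s) f (h s') f'.
Proof.
move=> hh; elim: n s f => [|n IH] s f /=; first by case=> -> ->.
by move=> [s1 [a [e p]]]; exists (h s1), a; split; [apply: hh | apply: IH].
Qed.

Definition skip := Mach tt (fun _ _ => None).

Definition prim (i : 'I_4) (g : bcell -> bcell) (mv : move) :=
  Mach true (fun (s : bool) sc => if s then Some (false, Some (i, (g (sc i), mv))) else None).

Definition mseq (M1 M2 : mach) := Mach (inl (mstart M1))
  (fun (s : mstate M1 + mstate M2) sc =>
    match s with
    | inl s => if mdelta s sc is Some (s', a) then Some (inl s', a)
               else Some (inr (mstart M2), None)
    | inr s => if mdelta s sc is Some (s', a) then Some (inr s', a) else None
    end).

Definition mwhile (i : 'I_4) (M : mach) := Mach None
  (fun (s : option (mstate M)) sc =>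
    match s with
    | None => if sc i is Some _ then Some (Some (mstart M), None) else None
    | Some s => if mdelta s sc is Some (s', a) then Some (Some s', a) else Some (None, None)
    end).

Definition mif (i : 'I_4) (M1 M2 : mach) := Mach None
  (fun (s : option (mstate M1 + mstate M2)) sc =>
    match s with
    | None => Some (Some (if sc i is Some (inl true) then inl (mstart M1)
                          else inr (mstart M2)), None)
    | Some (inl s) => if mdelta s sc is Some (s', a) then Some (Some (inl s'), a) else None
    | Some (inr s) => if mdelta s sc is Some (s', a) then Some (Some (inr s'), a) else None
    end).

Lemma runs_skip f : runs skip f f 0.
Proof. by exists 0, tt. Qed.

Lemma runs_prim i g mv f :
  runs (prim i g mv) f (upd f i (act (g (scanned (f i)), mv) (f i))) 1.
Proof. by exists 1, false; split=> //=; exists false; eexists; split. Qed.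

Lemma runs_seq M1 M2 f1 f2 f3 b1 b2 :
  runs M1 f1 f2 b1 -> runs M2 f2 f3 b2 -> runs (mseq M1 M2) f1 f3 (b1 + b2).+1.
Proof.
move=> [n1 [s1 [l1 p1 h1]]] [n2 [s2 [l2 p2 h2]]].
exists (n1 + n2.+1), (inr s2); split=> /=; [by lia | | by rewrite h2].
apply: (@path_cat (mseq M1 M2) _ _ _ _ (inl s1) f2).
  by apply: (@path_lift M1 (mseq M1 M2) inl) p1 => s sc s' a /= ->.
exists (inr (mstart M2)), None; rewrite /= h1; split=> //.
by apply: (@path_lift M2 (mseq M1 M2) inr) p2 => s sc s' a /= ->.
Qed.

Lemma runs_while_stop i M f : scanned (f i) = None -> runs (mwhile i M) f f 0.
Proof. by move=> h; exists 0, None; split=> //=; rewrite /mscan h. Qed.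

Lemma runs_while_go i M f1 f2 f3 b1 b2 : isSome (scanned (f1 i)) ->
  runs M f1 f2 b1 -> runs (mwhile i M) f2 f3 b2 ->
  runs (mwhile i M) f1 f3 (b1 + 2 + b2).
Proof.
move=> h [n1 [s1 [l1 p1 h1]]] [n2 [s2 [l2 p2 h2]]].
exists (n1.+1 + n2.+1), s2; split; [by lia | | by []].
exists (Some (mstart M)), None; split.
  by rewrite /= /mscan; case: (scanned (f1 i)) h.
apply: (@path_cat (mwhile i M) _ _ _ _ (Some s1) f2).
  by apply: (@path_lift M (mwhile i M) Some) p1 => s sc s' a /= ->.
by exists None, None; rewrite /= h1.
Qed.

Lemma runs_if i M1 M2 f f' b x : scanned (f i) = Some (inl x) ->
  runs (if x then M1 else M2) f f' b -> runs (mif i M1 M2) f f' b.+1.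
Proof.
move=> h; case: x h => h [n [s [l p hs]]].
- exists n.+1, (Some (inl s)); split=> //=; last by rewrite hs.
  exists (Some (inl (mstart M1))), None; rewrite /mscan h; split=> //.
  by apply: (@path_lift M1 (mif i M1 M2) (Some \o inl)) p => ? ? ? ? /= ->.
- exists n.+1, (Some (inr s)); split=> //=; last by rewrite hs.
  exists (Some (inr (mstart M2))), None; rewrite /mscan h; split=> //.
  by apply: (@path_lift M2 (mif i M1 M2) (Some \o inr)) p => ? ? ? ? /= ->.
Qed.

Lemma runs_while i M (f : nat -> env) n b :
  (forall j, j < n -> isSome (scanned (f j i))) -> scanned (f n i) = None ->
  (forall j, j < n -> runs M (f j) (f j.+1) b) ->
  runs (mwhile i M) (f 0) (f n) (n * (b + 2)).
Proof.
elim: n f => [|n IH] f go stop body; first exact: runs_while_stop.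
rewrite mulSn; apply: (@runs_while_go _ _ _ (f 1)); [exact: go | exact: body |].
by apply: (IH (f \o succn)) => [j jn||j jn] //=; [apply: go | apply: body].
Qed.

(** * Translation of programs into Turing machines *)

Definition to_TM (M : mach) : TM :=
  @MkTM (mstate M) void 3 (mstart M) predT
    (fun s (sc : 4.-tuple bcell) =>
      if mdelta s (tnth sc) is Some (s', a)
      then Some (s', [tuple if a is Some (j, b) then (if i == j then b else (tnth sc i, MoveN))
                            else (tnth sc i, MoveN) | i < 4])
      else None).

Definition to_config (M : mach) (s : mstate M) (f : env) : config (to_TM M) :=
  (s, [tuple f i | i < 4]).

Lemma tnth_scan (f : env) : tnth (map_tuple (@scanned void) [tuple f i | i < 4]) = mscan f.
Proof. by apply: functional_extensionality => i; rewrite tnth_map tnth_mktuple. Qed.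

Lemma step_to_config M s f :
  step (@to_config M s f) =
  if mdelta s (mscan f) is Some (s', a) then Some (to_config s' (perform a f)) else None.
Proof.
rewrite /step /= tnth_scan; case: (mdelta s _) => [[s' a]|] //; congr (Some (_, _)).
apply: eq_from_tnth => i; rewrite !tnth_mktuple.
(* A Turing machine acts on every tape; writing back the scanned symbol without moving leaves the
   idle tapes literally unchanged. *)
have stay : act (mscan f i, MoveN) (f i) = f i by rewrite /mscan; case: (f i).
by case: a => [[j b]|] //=; rewrite /upd; case: eqP => [->|].
Qed.

Lemma run_halted M n (c : config M) : halted c -> run n c = c.
Proof.
rewrite /halted /run => h; elim: n => [|n IH] //=; rewrite IH.
by case: (step c) h.
Qed.

Lemma run_add M n n' (c : config M) : run (n + n') c = run n (run n' c).
Proof. by rewrite /run iterD. Qed.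

Lemma run_path M n s f s' f' : @path M n s f s' f' ->
  run n (to_config s f) = to_config s' f'.
Proof.
elim: n s f => [|n IH] s f; first by case=> -> ->.
move=> [s1 [a [e p]]]; rewrite -(IH _ _ p) /run iterSr.
by congr (iter n _ _); rewrite step_to_config e.
Qed.

Definition init_env (w : word) : env :=
  fun i => word_tape void (if i == ord0 then w else [::]).

Lemma runs_computes M (F : word -> word) (b : nat -> nat) :
  (forall w, exists f, runs M (init_env w) f (b (size w)) /\
     bit_prefix (scanned (f ord_max) :: right (f ord_max)) = F w) ->
  computes_in_time (to_TM M) b F.
Proof.
move=> h w; have [f [[n [s [nb p hs]]] hF]] := h w.
have -> : init (to_TM M) w = to_config (mstart M) (init_env w) by [].
have hal : halted (to_config s f) by rewrite /halted step_to_config hs.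
rewrite -(subnK nb) run_add (run_path p) run_halted //; split=> //.
by rewrite /output tnth_mktuple.
Qed.

(** * Tapes holding one word between two blanks *)

Definition padded (s : word) : seq bcell :=
  None :: rcons (map (@bit_cell void) s) None.

(** Tapes are compared as lists, and lists that differ in trailing blanks are different. With one
    explicit blank at each end, moving the head between positions [0] and [(size s).+1] stays within
    this one representation, and both ends are recognised by their blank. *)
Definition ztape (s : word) (p : nat) : btape :=
  Tape (rev (take p (padded s))) (nth None (padded s) p) (drop p.+1 (padded s)).

Lemma size_padded s : size (padded s) = (size s).+2.
Proof. by rewrite /= size_rcons size_map. Qed.

Lemma ztapeR s p : p <= size s ->
  act (scanned (ztape s p), MoveR) (ztape s p) = ztape s p.+1.
Proof.
move=> le; rewrite /act /=.
have lt : p < size (padded s) by rewrite size_padded; lia.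
have lt' : p.+1 < size (padded s) by rewrite size_padded; lia.
rewrite /ztape -/(padded s) (take_nth None lt) rev_rcons.
have -> : drop p (rcons (map (@bit_cell void) s) None) = drop p.+1 (padded s) by [].
by rewrite (drop_nth None lt').
Qed.

Lemma ztapeL s p : p <= size s ->
  act (scanned (ztape s p.+1), MoveL) (ztape s p.+1) = ztape s p.
Proof.
move=> le; rewrite /act.
have lt : p < size (padded s) by rewrite size_padded; lia.
have lt' : p.+1 < size (padded s) by rewrite size_padded; lia.
rewrite /ztape (take_nth None lt) rev_rcons /=; congr Tape.
have -> : drop p (rcons (map (@bit_cell void) s) None) = drop p.+1 (padded s) by [].
by rewrite (drop_nth None lt').
Qed.

Lemma scan_ztape_home s : scanned (ztape s (size s).+1) = None.
Proof. by rewrite /ztape /= nth_rcons size_map ltnn eqxx. Qed.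

Lemma scan_ztape s p : p < size s -> scanned (ztape s p.+1) = Some (inl (nth false s p)).
Proof. by move=> lt; rewrite /ztape /= nth_rcons size_map lt (nth_map false). Qed.

Lemma ztape_append s b :
  act (bit_cell void b, MoveR) (ztape s (size s).+1) = ztape (rcons s b) (size s).+2.
Proof.
pose q := None :: map (@bit_cell void) s.
have sq : size q = (size s).+1 by rewrite /= size_map.
have -> : ztape s (size s).+1 = Tape (rev q) None [::].
  rewrite /ztape -/(padded s) (_ : padded s = rcons q None) // -sq -cats1.
  by rewrite take_size_cat // nth_cat ltnn subnn drop_oversize // size_cat addn1.
have e : padded (rcons s b) = rcons (rcons q (bit_cell void b)) None.
  by rewrite /padded map_rcons.
rewrite /ztape e -sq -!(size_rcons q (bit_cell void b)) -(cats1 (rcons _ _)).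
rewrite take_size_cat // nth_cat ltnn subnn drop_oversize ?size_cat ?addn1 //.
by rewrite rev_rcons.
Qed.

(** A mark either overwrites an old mark or, on the right blank, lengthens the counter; [maxn]
    covers both cases. *)
Lemma ztape_write b j : j <= b ->
  act (bit_cell void true, MoveR) (ztape (nseq b true) j.+1) =
  ztape (nseq (maxn b j.+1) true) j.+2.
Proof.
rewrite leq_eqVlt => /orP[/eqP->|lt].
  have := ztape_append (nseq b true) true; rewrite size_nseq => ->.
  by congr ztape; rewrite (maxn_idPr (leqnSn b)) -(addn1 b) nseqD cats1.
rewrite (maxn_idPl lt) -[RHS]ztapeR ?size_nseq //.
by rewrite scan_ztape ?size_nseq // nth_nseq lt.
Qed.

Definition tout : 'I_4 := ord_max.
Definition tin : 'I_4 := ord0.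
Definition tX : 'I_4 := @Ordinal 4 1 isT.
Definition tY : 'I_4 := @Ordinal 4 2 isT.

(* The output [o] lies to the right of the head of the output tape, so that every
   printed bit is put in front: a program prints the end of its output first. *)
Definition st (S : 'I_4 -> word) (p : 'I_4 -> nat) (o : word) : env :=
  fun i => if i == tout then Tape [::] None (map (@bit_cell void) o) else ztape (S i) (p i).

Definition put (T : Type) (p : 'I_4 -> T) i (v : T) : 'I_4 -> T :=
  fun j => if j == i then v else p j.

Lemma putE T (p : 'I_4 -> T) i v : put p i v i = v.
Proof. by rewrite /put eqxx. Qed.

Lemma putN T (p : 'I_4 -> T) i v j : j != i -> put p i v j = p j.
Proof. by rewrite /put => /negPf->. Qed.

Lemma put_put T (p : 'I_4 -> T) i v v' : put (put p i v) i v' = put p i v'.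
Proof. by apply: functional_extensionality => j; rewrite /put; case: eqP. Qed.

Lemma put_id T (p : 'I_4 -> T) i v : p i = v -> put p i v = p.
Proof. by move=> <-; apply: functional_extensionality => j; rewrite /put; case: eqP => [->|]. Qed.

Lemma putC T (p : 'I_4 -> T) i j v v' : i != j ->
  put (put p i v) j v' = put (put p j v') i v.
Proof.
move=> ij; apply: functional_extensionality => x; rewrite /put.
by case: (x =P j) => [->|//]; rewrite eq_sym (negPf ij).
Qed.

(** * Head moves, marks and loops over the letters of a tape *)

Definition goto (i : 'I_4) mv := prim i id mv.
Definition emit (b : bool) := prim tout (fun=> bit_cell void b) MoveL.
Definition mark (i : 'I_4) := prim i (fun=> bit_cell void true) MoveR.

Lemma upd_st S p o i t : i != tout -> forall S' p',
  t = ztape (S' i) (p' i) -> (forall j, j != i -> S' j = S j) -> (forall j, j != i -> p' j = p j) ->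
  upd (st S p o) i t = st S' p' o.
Proof.
move=> ni S' p' -> eS ep; apply: functional_extensionality => j; rewrite /upd /st.
case: eqP => [->|/eqP ji]; first by rewrite (negPf ni).
by case: eqP => // _; rewrite eS ?ep.
Qed.

Lemma runs_gotoR i S p o : i != tout -> p i <= size (S i) ->
  runs (goto i MoveR) (st S p o) (st S (put p i (p i).+1) o) 1.
Proof.
move=> ni le; have := runs_prim i id MoveR (st S p o).
rewrite (@upd_st _ _ _ _ _ ni S (put p i (p i).+1)) //.
  by rewrite putE /st (negPf ni) ztapeR.
by move=> j; apply: putN.
Qed.

Lemma runs_gotoL i S p o q : i != tout -> p i = q.+1 -> q <= size (S i) ->
  runs (goto i MoveL) (st S p o) (st S (put p i q) o) 1.
Proof.
move=> ni e le; have := runs_prim i id MoveL (st S p o).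
rewrite (@upd_st _ _ _ _ _ ni S (put p i q)) //.
  by rewrite putE /st (negPf ni) e ztapeL.
by move=> j; apply: putN.
Qed.

Lemma runs_mark i S p o b j : i != tout -> S i = nseq b true -> p i = j.+1 -> j <= b ->
  runs (mark i) (st S p o) (st (put S i (nseq (maxn b j.+1) true)) (put p i j.+2) o) 1.
Proof.
move=> ni eS ep le.
have := runs_prim i (fun=> bit_cell void true) MoveR (st S p o).
rewrite (@upd_st _ _ _ _ _ ni (put S i (nseq (maxn b j.+1) true)) (put p i j.+2)) //.
- by rewrite !putE /st (negPf ni) eS ep ztape_write.
- by move=> ?; apply: putN.
- by move=> ?; apply: putN.
Qed.

Lemma runs_emit b S p o : runs (emit b) (st S p o) (st S p (b :: o)) 1.
Proof.
have := runs_prim tout (fun=> bit_cell void b) MoveL (st S p o).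
congr runs; apply: functional_extensionality => j; rewrite /upd /st.
by case: eqP.
Qed.

Lemma scan_st0 S p o i : i != tout -> p i = 0 -> scanned (st S p o i) = None.
Proof. by rewrite /st => /negPf-> ->. Qed.

Lemma scan_st_home S p o i : i != tout -> p i = (size (S i)).+1 ->
  scanned (st S p o i) = None.
Proof. by rewrite /st => /negPf-> ->; apply: scan_ztape_home. Qed.

Lemma scan_st S p o i j : i != tout -> p i = j.+1 -> j < size (S i) ->
  scanned (st S p o i) = Some (inl (nth false (S i) j)).
Proof. by rewrite /st => /negPf-> ->; apply: scan_ztape. Qed.

Definition rewind x := mwhile x (goto x MoveR).

Lemma runs_rewind x S p o : x != tout -> 0 < p x <= (size (S x)).+1 ->
  runs (rewind x) (st S p o) (st S (put p x (size (S x)).+1) o) (3 * size (S x)).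
Proof.
move=> nx /andP[p0 le].
pose N := (size (S x)).+1 - p x.
have := @runs_while x (goto x MoveR) (fun j => st S (put p x (p x + j)) o) N 1.
rewrite addn0 (@put_id _ _ _ (p x)) // (_ : p x + N = (size (S x)).+1); last by rewrite /N; lia.
move=> h; apply: runs_le (h _ _ _); first by rewrite /N; lia.
- move=> j jN; rewrite (@scan_st _ _ _ _ (p x + j).-1) ?putE //; rewrite /N in jN; lia.
- by rewrite scan_st_home ?putE.
- move=> j jN; rewrite /N in jN.
  have := @runs_gotoR x S (put p x (p x + j)) o nx.
  by rewrite put_put !putE addnS; apply; lia.
Qed.

(** Letters are visited from right to left because the output is printed back to front: the words
    printed by the iterations end up in increasing order of position. *)
Definition loop x c :=
  mseq (goto x MoveL) (mseq (mwhile x (mseq c (goto x MoveL)))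
    (mseq (goto x MoveR) (rewind x))).

Lemma runs_loop x c b n (S : nat -> 'I_4 -> word) (p : nat -> 'I_4 -> nat) (o : nat -> word) :
  x != tout -> (forall j, size (S j x) = n) -> p 0 x = n.+1 ->
  (forall j, j < n ->
     runs c (st (S j) (put (p j) x (n - j)) (o j))
            (st (S j.+1) (put (p j.+1) x (n - j)) (o j.+1)) b) ->
  runs (loop x c) (st (S 0) (p 0) (o 0)) (st (S n) (put (p n) x n.+1) (o n))
    (n * (b + 7) + 5).
Proof.
move=> nx sz p0 body.
pose f j := st (S j) (put (p j) x (n - j)) (o j).
apply: (@runs_le _ _ _ (1 + (n * (b.+2 + 2) + (1 + 3 * n).+1).+1).+1); first by lia.
apply: (@runs_seq _ _ _ (f 0)).
  rewrite /f subn0; apply: runs_gotoL => //; rewrite sz; exact: leqnn.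
apply: (@runs_seq _ _ _ (f n)).
  apply: runs_while.
  - by move=> j jn; rewrite (@scan_st _ _ _ _ (n - j).-1) ?putE ?sz //; lia.
  - by rewrite scan_st0 ?putE ?subnn.
  move=> j jn; apply: (@runs_le _ _ _ (b + 1).+1); first by lia.
  apply: (runs_seq (body _ jn)).
  have := @runs_gotoL x (S j.+1) (put (p j.+1) x (n - j)) (o j.+1) (n - j.+1) nx.
  by rewrite putE put_put sz; apply; lia.
apply: (@runs_seq _ _ _ (st (S n) (put (p n) x 1) (o n))).
  have := @runs_gotoR x (S n) (put (p n) x 0) (o n) nx.
  by rewrite /f subnn putE put_put sz; apply.
have := @runs_rewind x (S n) (put (p n) x 1) (o n) nx.
by rewrite putE put_put sz; apply.
Qed.

Definition emits (c : mach) (u : word) (b : nat) : Prop :=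
  forall S p o, runs c (st S p o) (st S p (u ++ o)) b.

Fixpoint print (u : word) : mach :=
  if u is b :: u' then mseq (print u') (emit b) else skip.

Lemma print_emits u : emits (print u) u (2 * size u).
Proof.
elim: u => [|b u IH] S p o; first exact: runs_skip.
apply: runs_le (runs_seq (IH S p o) (runs_emit b S p _)); rewrite /=; lia.
Qed.

(* [c] is run once per step of the head of [x]; the head of [tY] counts these
   steps, which allows the head of [x] to be put back. *)
Definition sweep x mv mv' c :=
  mseq (goto x mv) (mseq (mwhile x (mseq c (mseq (goto tY MoveL) (goto x mv))))
    (mseq (mwhile tY (mseq (goto tY MoveR) (goto x mv'))) (goto x mv'))).

Lemma runs_sweep x mv mv' c u b S p o (pos : nat -> nat) k :
  x != tout -> x != tY -> p x = pos 0 -> p tY = (size (S tY)).+1 -> k <= size (S tY) ->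
  (forall j p o, j <= k -> p x = pos j ->
     runs (goto x mv) (st S p o) (st S (put p x (pos j.+1)) o) 1) ->
  (forall j p o, j <= k -> p x = pos j.+1 ->
     runs (goto x mv') (st S p o) (st S (put p x (pos j)) o) 1) ->
  (forall j p o, j < k -> p x = pos j.+1 -> isSome (scanned (st S p o x))) ->
  (forall p o, p x = pos k.+1 -> scanned (st S p o x) = None) ->
  emits c u b ->
  runs (sweep x mv mv' c) (st S p o) (st S p (flatten (nseq k u) ++ o)) (k * (b + 11) + 5).
Proof.
move=> nx xY p0 pY kY go back inside stop cu.
have nY : tY != tout by [].
have Yx : tY != x by rewrite eq_sym.
(* [f j] is the situation after [j] printed words and [g j] the one after [j] steps back. The first
   move of [x] is not counted on [tY]; the last move undoes it. *)
pose f j := st S (put (put p x (pos j.+1)) tY ((size (S tY)).+1 - j)) (flatten (nseq j u) ++ o).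
pose g j := st S (put (put p x (pos (k.+1 - j))) tY ((size (S tY)).+1 - k + j)) (flatten (nseq k u) ++ o).
apply: (@runs_le _ _ _ (1 + (k * ((b + (1 + 1).+1).+1 + 2) + (k * ((1 + 1).+1 + 2) + 1).+1).+1).+1); first by lia.
apply: (@runs_seq _ _ _ (f 0)).
  by rewrite /f subn0 putC // -pY (@put_id _ p) //; apply: go.
apply: (@runs_seq _ _ _ (f k)).
  apply: runs_while.
  - by move=> j jk; apply: (inside j); rewrite // putN // putE.
  - by apply: stop; rewrite putN // putE.
  move=> j jk; apply: runs_seq (cu _ _ _) _.
  apply: runs_seq (@runs_gotoL _ _ _ _ ((size (S tY)).+1 - j.+1) nY _ _) _.
  - rewrite putE; lia.
  - lia.
  have := go j.+1 (put (put p x (pos j.+1)) tY ((size (S tY)).+1 - j.+1)) (u ++ flatten (nseq j u) ++ o) jk.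
  rewrite put_put putN // putE => /(_ erefl).
  by rewrite /f (@putC _ _ tY x) // put_put /= -catA.
apply: (@runs_seq _ _ _ (g k)).
  have -> : f k = g 0 by rewrite /f /g subn0 addn0.
  apply: runs_while.
  - move=> j jk; rewrite (@scan_st _ _ _ _ ((size (S tY)).+1 - k + j).-1) ?putE //; lia.
  - by rewrite scan_st_home ?putE //; lia.
  move=> j jk; apply: runs_seq (runs_gotoR _ nY _) _.
    rewrite putE; lia.
  rewrite put_put putE.
  have := back (k - j) (put (put p x (pos (k.+1 - j))) tY ((size (S tY)).+1 - k + j).+1) (flatten (nseq k u) ++ o).
  rewrite putN // putE -subSn ?(ltnW jk) //.
  move=> /(_ _ erefl); rewrite /g putC // put_put (_ : k.+1 - j.+1 = k - j) //.
  by rewrite addnS (@putC _ p x tY) //; apply; lia.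
have -> : g k = st S (put p x (pos 1)) (flatten (nseq k u) ++ o).
  rewrite /g; congr st; rewrite putC //.
  by rewrite (@put_id _ p tY) ?subSnn //; lia.
have := back 0 (put p x (pos 1)) (flatten (nseq k u) ++ o).
by rewrite putE put_put -p0 (@put_id _ p x (p x)) //; apply.
Qed.

Definition before x c := sweep x MoveL MoveR c.
Definition after x c := sweep x MoveR MoveL c.

Lemma runs_before x c u b S p o l :
  x != tout -> x != tY -> p x = l.+1 -> l <= size (S x) ->
  p tY = (size (S tY)).+1 -> l <= size (S tY) -> emits c u b ->
  runs (before x c) (st S p o) (st S p (flatten (nseq l u) ++ o)) (l * (b + 11) + 5).
Proof.
move=> nx xY px lx pY lY cu.
apply: (@runs_sweep _ _ _ _ _ _ _ _ _ (fun j => l.+1 - j)) => // [j q o' jl qx|j q o' jl qx|j q o' jl qx|q o' qx].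
- by apply: runs_gotoL => //; lia.
- by have := @runs_gotoR x S q o' nx; rewrite qx subSS -subSn //; apply; lia.
- by rewrite (@scan_st _ _ _ _ (l - j).-1) //; lia.
- by rewrite scan_st0 // qx subnn.
Qed.

Lemma runs_after x c u b S p o l :
  x != tout -> x != tY -> p x = l.+1 -> l < size (S x) ->
  p tY = (size (S tY)).+1 -> size (S x) <= size (S tY) -> emits c u b ->
  runs (after x c) (st S p o) (st S p (flatten (nseq (size (S x) - l.+1) u) ++ o))
    ((size (S x) - l.+1) * (b + 11) + 5).
Proof.
move=> nx xY px lx pY lY cu.
apply: (@runs_sweep _ _ _ _ _ _ _ _ _ (fun j => l.+1 + j)) => // [|||j q o' jl qx|j q o' jl qx|q o' qx].
- by rewrite addn0.
- lia.
- by move=> j q o' jl qx; have := @runs_gotoR x S q o' nx; rewrite qx addnS; apply; lia.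
- by apply: runs_gotoL => //; lia.
- by rewrite (@scan_st _ _ _ _ (l.+1 + j)) //; lia.
- by rewrite scan_st_home // qx; lia.
Qed.

(** * Unary counters of polynomial length *)

Definition contents (w : word) (a b : nat) : 'I_4 -> word :=
  fun i => if i == tin then w else if i == tX then nseq a true
           else if i == tY then nseq b true else [::].

Lemma size_contentsX w a b : size (contents w a b tX) = a.
Proof. by rewrite /contents /= size_nseq. Qed.

Lemma size_contentsY w a b : size (contents w a b tY) = b.
Proof. by rewrite /contents /= size_nseq. Qed.

Definition home (S : 'I_4 -> word) : 'I_4 -> nat := fun i => (size (S i)).+1.

Definition stc w a b o := st (contents w a b) (home (contents w a b)) o.

Lemma contentsX w a b a' : put (contents w a b) tX (nseq a' true) = contents w a' b.
Proof.
by apply: functional_extensionality => i; rewrite /put /contents; case: (i =P tX) => [->|].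
Qed.

Lemma contentsY w a b b' : put (contents w a b) tY (nseq b' true) = contents w a b'.
Proof.
by apply: functional_extensionality => i; rewrite /put /contents; case: (i =P tY) => [->|].
Qed.

Lemma homeX w a b a' : put (home (contents w a b)) tX a'.+1 = home (contents w a' b).
Proof.
apply: functional_extensionality => i; rewrite /put /home /contents.
by case: (i =P tX) => [->|//]; rewrite /= size_nseq.
Qed.

Lemma homeY w a b b' : put (home (contents w a b)) tY b'.+1 = home (contents w a b').
Proof.
apply: functional_extensionality => i; rewrite /put /home /contents.
by case: (i =P tY) => [->|//]; rewrite /= size_nseq.
Qed.

(** One step left and back makes the left blank of the input explicit, and one step right does the
    same for the two empty counters. Afterwards every head except that of the output is on a right
    blank. *)
Definition setup := mseq (goto tin MoveL) (mseq (goto tin MoveR)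
  (mseq (rewind tin) (mseq (goto tX MoveR) (goto tY MoveR)))).

Lemma runs_setup w : runs setup (init_env w) (stc w 0 0 [::]) (3 * size w + 8).
Proof.
(* The flags tell which of the two counter tapes already has its explicit left blank. *)
pose f t (b b' : bool) : env := fun i => if i == tin then t else
  if i == tX then if b then ztape [::] 1 else word_tape void [::] else
  if i == tY then if b' then ztape [::] 1 else word_tape void [::] else word_tape void [::].
have upf t b b' t' : upd (f t b b') tin t' = f t' b b'.
  by apply: functional_extensionality => i; rewrite /upd /f; case: eqP.
have move0 t b b' mv : runs (goto tin mv) (f t b b') (f (act (scanned t, mv) t) b b') 1.
  by have := runs_prim tin id mv (f t b b'); rewrite upf.
pose s := map (@bit_cell void) w.
pose t j := Tape (rev (None :: take j s)) (head None (drop j s)) (behead (drop j s)).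
apply: (@runs_le _ _ _ (1 + (1 + (3 * size w + (1 + 1).+1).+1).+1).+1); first by lia.
have -> : init_env w = f (word_tape void w) false false.
  by apply: functional_extensionality => -[[|[|[|[|//]]]] i4].
apply: runs_seq (move0 _ _ _ _) _; apply: runs_seq (move0 _ _ _ _) _.
apply: (@runs_seq _ _ _ (f (ztape w (size w).+1) false false)).
  have -> : f (ztape w (size w).+1) false false = f (t (size s)) false false.
    congr f; rewrite /t take_size drop_size /ztape /padded -rcons_cons -/s -cats1.
    have -> : (size w).+1 = size (None :: s) by rewrite /= size_map.
    by rewrite take_size_cat // nth_cat ltnn subnn drop_oversize // size_cat addn1.
  have -> : act (scanned (act (scanned (word_tape void w), MoveL) (word_tape void w)), MoveR)
    (act (scanned (word_tape void w), MoveL) (word_tape void w)) = t 0 by rewrite /t take0 drop0.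
  apply: runs_le (@runs_while tin _ (fun j => f (t j) false false) (size s) 1 _ _ _); first by rewrite size_map; lia.
  - move=> j js; rewrite /f eqxx /t /= (drop_nth None js) /=.
    by rewrite (nth_map false) // -(size_map (@bit_cell void)).
  - by rewrite /f eqxx /t drop_size.
  move=> j js; have := move0 (t j) false false MoveR.
  rewrite /t (take_nth None js) (drop_nth None js) /act /= !rev_cons rev_rcons.
  by rewrite rcons_cons.
apply: (@runs_seq _ _ _ (f (ztape w (size w).+1) true false)).
  have := runs_prim tX id MoveR (f (ztape w (size w).+1) false false).
  by congr runs; apply: functional_extensionality => -[[|[|[|[|//]]]] i4].
have := runs_prim tY id MoveR (f (ztape w (size w).+1) true false).
by congr runs; apply: functional_extensionality => -[[|[|[|[|//]]]] i4].
Qed.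

Lemma runs_markX w a b o : runs (mark tX) (stc w a b o) (stc w a.+1 b o) 1.
Proof.
have := @runs_mark tX (contents w a b) (home (contents w a b)) o a a isT erefl.
rewrite {1}/home {1}/contents /= size_nseq => /(_ erefl (leqnn _)).
by rewrite (maxn_idPr (leqnSn a)) homeX contentsX.
Qed.

Fixpoint marks a := if a is a'.+1 then mseq (mark tX) (marks a') else skip.

Lemma runs_marks a w a0 b o : runs (marks a) (stc w a0 b o) (stc w (a0 + a) b o) (2 * a).
Proof.
elim: a a0 => [|a IH] a0; first by rewrite addn0; apply: runs_skip.
by rewrite addnS -addSn; apply: runs_le (runs_seq (runs_markX _ _ _ _) (IH _)); lia.
Qed.

Definition unwind x := mseq (goto x MoveL) (mseq (mwhile x (goto x MoveL)) (goto x MoveR)).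

Lemma runs_unwind x S p o : x != tout -> p x = (size (S x)).+1 ->
  runs (unwind x) (st S p o) (st S (put p x 1) o) (3 * size (S x) + 4).
Proof.
move=> nx px; set n := size (S x).
apply: (@runs_le _ _ _ (1 + (n * (1 + 2) + 1).+1).+1); first by lia.
pose f j := st S (put p x (n - j)) o.
apply: (@runs_seq _ _ _ (f 0)); first by rewrite /f subn0; apply: runs_gotoL.
apply: (@runs_seq _ _ _ (f n)).
  apply: runs_while.
  - by move=> j jn; rewrite (@scan_st _ _ _ _ (n - j).-1) ?putE //; rewrite /n in jn *; lia.
  - by rewrite scan_st0 ?putE ?subnn.
  move=> j jn; have := @runs_gotoL x S (put p x (n - j)) o (n - j.+1) nx.
  by rewrite putE put_put; apply; rewrite /n in jn *; lia.
have := @runs_gotoR x S (put p x 0) o nx.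
by rewrite /f subnn putE put_put; apply.
Qed.

(** Old marks of [tY] are overwritten and then extended, which is why the old value of [tY] must not
    exceed that of [tX]. *)
Definition copyXY := mseq (unwind tX) (mseq (unwind tY)
  (mwhile tX (mseq (mark tY) (goto tX MoveR)))).

Lemma runs_copyXY w a b o : b <= a ->
  runs copyXY (stc w a b o) (stc w a a o) (11 * a + 10).
Proof.
move=> ba.
apply: (@runs_le _ _ _ ((3 * a + 4) + ((3 * a + 4) + a * (1 + 1).+2.+1).+1).+1); first by lia.
pose h := home (contents w a b).
apply: (@runs_seq _ _ _ (st (contents w a b) (put h tX 1) o)).
  by have := @runs_unwind tX (contents w a b) h o isT erefl; rewrite {3}/contents /= size_nseq.
pose f j := st (contents w a (maxn b j)) (put (put h tX j.+1) tY j.+1) o.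
apply: (@runs_seq _ _ _ (f 0)).
  rewrite /f maxn0.
  have := @runs_unwind tY (contents w a b) (put h tX 1) o isT erefl.
  rewrite {3}/contents /= size_nseq => hh; apply: runs_le hh; lia.
have -> : stc w a a o = f a.
  rewrite /f (maxn_idPr ba) /stc; congr st; rewrite homeX homeY //.
rewrite -[(1 + 1).+3]addn2.
apply: runs_while.
- move=> j ja; rewrite (@scan_st _ _ _ _ j) //; last by rewrite /contents /= size_nseq.
- by rewrite scan_st_home // /put /contents /= size_nseq.
move=> j ja.
have mk := @runs_mark tY (contents w a (maxn b j)) (put (put h tX j.+1) tY j.+1) o (maxn b j) j isT erefl.
rewrite putE in mk; apply: runs_seq (mk erefl (leq_maxr _ _)) _.
rewrite put_put contentsY.
have := @runs_gotoR tX (contents w a (maxn (maxn b j) j.+1)) (put (put h tX j.+1) tY j.+2) o isT.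
rewrite (@putC _ h tX tY) // put_put putE size_contentsX ja => /(_ isT).
by rewrite /f (@putC _ h tX tY) // -maxnA (maxn_idPr (leqnSn j)).
Qed.

(** [tX] grows by [tY] once per input letter. Starting from equal counters this multiplies by
    [(size w).+1], a positive factor even on the empty input. *)
Definition mult := loop tin (loop tY (mark tX)).

Lemma runs_mult w a o :
  runs mult (stc w a a o) (stc w (a * (size w).+1) a o)
    (size w * ((a * 8 + 5) + 7) + 5).
Proof.
pose C j := contents w (a + j * a) a.
have -> : stc w (a * (size w).+1) a o =
    st (C (size w)) (put (home (C (size w))) tin (size w).+1) o.
  by rewrite put_id // /stc /C mulnS (mulnC a).
have -> : stc w a a o = st (C 0) (home (C 0)) o by rewrite /stc /C mul0n addn0.
apply: (@runs_loop tin _ _ _ C (home \o C) (fun=> o)) => // j jn; rewrite /comp.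
pose D i := contents w (a + j * a + i) a; pose h i := put (home (D i)) tin (size w - j).
have -> : C j = D 0 by rewrite /D addn0.
have -> : C j.+1 = D a by rewrite /D /C mulSn; congr contents; lia.
rewrite -/(h 0) -/(h a).
rewrite -[8]/(1 + 7) -(@put_id _ (h a) tY a.+1); last by rewrite /h putN // /home size_contentsY.
apply: (@runs_loop tY _ _ _ D h (fun=> o)) => // [i||i ia].
- exact: size_contentsY.
- by rewrite /h putN // /home size_contentsY.
have := @runs_mark tX (D i) (put (h i) tY (a - i)) o (a + j * a + i) (a + j * a + i) isT erefl.
rewrite (maxn_idPr (leqnSn _)) contentsX (@putC _ (h i) tY tX) // /h.
rewrite (@putC _ (home (D i)) tin tX) // homeX /D addnS; apply=> //.
by rewrite !putN // /home size_contentsX.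
Qed.

(** The final copy makes the counters equal: later [tX] is looped over while [tY] records head
    steps. *)
Fixpoint power e := if e is e'.+1 then mseq copyXY (mseq mult (power e')) else copyXY.

Lemma runs_power e w a b o : b <= a ->
  exists t, t <= 30 * e.+1 * (a * (size w).+1 ^ e.+1 + (size w).+1) /\
  runs (power e) (stc w a b o) (stc w (a * (size w).+1 ^ e) (a * (size w).+1 ^ e) o) t.
Proof.
elim: e a b => [|e IH] a b ba.
  rewrite expn0 (muln1 a); exists (11 * a + 10); split; last exact: runs_copyXY.
  by rewrite expn1; nia.
have [t [le run]] := IH (a * (size w).+1) a (leq_pmulr a (ltn0Sn (size w))).
exists ((11 * a + 10) + ((size w * ((a * 8 + 5) + 7) + 5) + t).+1).+1; split; last first.
  rewrite expnS mulnA.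
  by apply: runs_seq (runs_copyXY _ _ ba) (runs_seq (runs_mult _ _ _) run).
rewrite -(mulnA a) -expnS in le.
have : a * (size w).+1 <= a * (size w).+1 ^ e.+2.
  by rewrite leq_mul2l -{1}(expn1 (size w).+1) leq_pexp2l // orbT.
move: (a * (size w).+1 ^ e.+2) le => Q le.
rewrite mulnS => aw.
have -> : 30 * e.+2 * (Q + (size w).+1) = 30 * e.+1 * (Q + (size w).+1) + 30 * (Q + (size w).+1).
  by rewrite -mulnDl -[30 in RHS]muln1 -mulnDr addn1.
have -> : size w * (a * 8 + 5 + 7) = 8 * (a * size w) + 12 * size w.
  by rewrite -addnA mulnDr mulnA (mulnC (size w) a) mulnC (mulnC _ 12).
move: (30 * e.+1 * _) (a * size w) le aw => B D; lia.
Qed.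

(** * Words printed by nested loops *)

Definition poly_bounded (f : nat -> nat) : Prop :=
  exists c d, forall n, f n <= c * n.+1 ^ d.

Lemma poly_const c : poly_bounded (fun=> c).
Proof. by exists c, 0 => n; rewrite muln1. Qed.

Lemma poly_id : poly_bounded id.
Proof. by exists 1, 1 => n; rewrite mul1n expn1. Qed.

Lemma poly_add f g : poly_bounded f -> poly_bounded g -> poly_bounded (fun n => f n + g n).
Proof.
move=> [c [d hf]] [c' [d' hg]]; exists (c + c'), (d + d') => n.
rewrite mulnDl; apply: leq_add.
  by apply: leq_trans (hf n) _; rewrite leq_mul2l leq_pexp2l ?orbT // leq_addr.
by apply: leq_trans (hg n) _; rewrite leq_mul2l leq_pexp2l ?orbT // leq_addl.
Qed.

Lemma poly_mul f g : poly_bounded f -> poly_bounded g -> poly_bounded (fun n => f n * g n).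
Proof.
move=> [c [d hf]] [c' [d' hg]]; exists (c * c'), (d + d') => n.
by rewrite expnD mulnACA leq_mul.
Qed.

Lemma poly_pow a e : poly_bounded (fun n => a * n.+1 ^ e).
Proof. by exists a, e. Qed.

Lemma leq_exp2r_le d m n : m <= n -> m ^ d <= n ^ d.
Proof. by case: d => // d; rewrite leq_exp2r. Qed.

(** For positive [n] one has [n.+1 <= 2 * n], at the cost of the factor [2 ^ d]; the additive
    constant takes care of [n = 0]. *)
Lemma poly_boundedW f : poly_bounded f -> exists c d, forall n, f n <= c * n ^ d + c.
Proof.
move=> [c [d h]]; exists (c * 2 ^ d), d => n; apply: leq_trans (h n) _.
rewrite -mulnA -mulnDr leq_mul2l; apply/orP; right.
case: n {h} => [|n]; first by rewrite exp1n addn_gt0 expn_gt0 orbT.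
apply: (@leq_trans (2 ^ d * n.+1 ^ d)); last exact: leq_addr.
by rewrite -expnMn; apply: leq_exp2r_le; lia.
Qed.

Section Emit.
Variables (c0 e0 : nat).
(** The successors make the value exceed [n], so that a counter of this length can also record head
    steps on the input tape. *)
Definition msize n := c0.+1 * n.+1 ^ e0.+1.

Lemma msize_gt n : n < msize n.
Proof.
rewrite /msize expnS; apply: (@leq_trans (n.+1 * n.+1 ^ e0)).
  by apply: leq_pmulr; rewrite expn_gt0.
by apply: leq_pmull.
Qed.

Definition mw (w : word) := msize (size w).
Definition cw (w : word) := contents w (mw w) (mw w).

Definition pos (w : word) (i l : nat) : 'I_4 -> nat :=
  put (put (home (cw w)) tin i.+1) tX l.+1.

Definition est w i l o := st (cw w) (pos w i l) o.

Definition inrange (b : bool) (i N : nat) : bool := if b then i < N else i == N.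

(** A flag [true] says that the head is on a letter, as inside a loop; [false] says that it is on
    the right blank. In the second case [i] is [size w] or [l] is [mw w], so the same printers also
    produce these lengths. *)
Definition emittable (bi bl : bool) (e : word -> nat -> nat -> word) : Prop :=
  exists c q, poly_bounded q /\
    forall w i l o, inrange bi i (size w) -> inrange bl l (mw w) ->
      runs c (est w i l o) (est w i l (e w i l ++ o)) (q (size w)).

Lemma emit_ext bi bl e e' : emittable bi bl e ->
  (forall w i l, inrange bi i (size w) -> inrange bl l (mw w) -> e' w i l = e w i l) ->
  emittable bi bl e'.
Proof.
move=> [c [q [qp h]]] ee; exists c, q; split=> // w i l o wi wl.
by rewrite ee //; apply: h.
Qed.

Lemma emit_const bi bl u : emittable bi bl (fun _ _ _ => u).
Proof.
exists (print u), (fun=> 2 * size u); split; first exact: poly_const.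
by move=> w i l o _ _; apply: print_emits.
Qed.

Lemma emit_cat bi bl e1 e2 : emittable bi bl e1 -> emittable bi bl e2 ->
  emittable bi bl (fun w i l => e1 w i l ++ e2 w i l).
Proof.
move=> [c1 [q1 [p1 h1]]] [c2 [q2 [p2 h2]]].
exists (mseq c2 c1), (fun n => q2 n + q1 n + 1); split.
  by apply: poly_add (poly_const 1); apply: poly_add.
move=> w i l o wi wl; rewrite addn1 -catA.
by apply: runs_seq (h2 w i l o wi wl) (h1 w i l _ wi wl).
Qed.

Lemma pos_in w i l : pos w i l tin = i.+1.
Proof. by rewrite /pos putN // putE. Qed.
Lemma pos_X w i l : pos w i l tX = l.+1.
Proof. by rewrite /pos putE. Qed.
Lemma pos_Y w i l : pos w i l tY = (mw w).+1.
Proof. by rewrite /pos !putN // /home size_contentsY. Qed.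
Lemma put_pos_in w i l i' : put (pos w i l) tin i'.+1 = pos w i' l.
Proof. by rewrite /pos putC // put_put. Qed.
Lemma put_pos_X w i l l' : put (pos w i l) tX l'.+1 = pos w i l'.
Proof. by rewrite /pos put_put. Qed.

Lemma emit_if bl e1 e2 : emittable true bl e1 -> emittable true bl e2 ->
  emittable true bl (fun w i l => if nth false w i then e1 w i l else e2 w i l).
Proof.
move=> [c1 [q1 [p1 h1]]] [c2 [q2 [p2 h2]]].
exists (mif tin c1 c2), (fun n => q1 n + q2 n + 1); split.
  by apply: poly_add (poly_const 1); apply: poly_add.
move=> w i l o wi wl; rewrite addn1.
apply: (@runs_if _ _ _ _ _ _ (nth false w i)).
  by rewrite (@scan_st _ _ _ _ i) // pos_in.
case: ifP => _.
  by apply: runs_le (h1 w i l o wi wl); apply: leq_addr.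
by apply: runs_le (h2 w i l o wi wl); apply: leq_addl.
Qed.

Lemma iota_down N j : j < N -> iota (N - j.+1) j.+1 = (N - j.+1) :: iota (N - j) j.
Proof. by move=> jN /=; congr (_ :: iota _ _); lia. Qed.

Lemma emit_loop_in bl e : emittable true bl e ->
  emittable false bl (fun w _ l => flatten [seq e w i l | i <- iota 0 (size w)]).
Proof.
move=> [c [q [qp h]]]; exists (loop tin c), (fun n => n * (q n + 7) + 5); split.
  apply: poly_add (poly_const 5); apply: poly_mul poly_id _.
  exact: poly_add qp (poly_const 7).
move=> w _ l o /eqP-> wl; rewrite /est; set n := size w.
have := @runs_loop tin c (q n) n (fun=> cw w) (fun=> pos w n l)
  (fun j => flatten [seq e w i l | i <- iota (n - j) j] ++ o) isT.
rewrite put_pos_in subnn; apply=> // j jn; have -> : put (pos w n l) tin (n - j) = pos w (n - j.+1) l.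
  by rewrite -[RHS](put_pos_in w n l) -subSn // subSS.
rewrite iota_down // [flatten (map _ (_ :: _))]/= -catA.
by apply: h => //=; rewrite /n in jn *; lia.
Qed.

Lemma emit_loop_X bi e : emittable bi true e ->
  emittable bi false (fun w i _ => flatten [seq e w i l | l <- iota 0 (mw w)]).
Proof.
move=> [c [q [qp h]]]; exists (loop tX c), (fun n => msize n * (q n + 7) + 5); split.
  apply: poly_add (poly_const 5); apply: poly_mul; first exact: poly_pow.
  exact: poly_add qp (poly_const 7).
move=> w i _ o wi /eqP->; rewrite /est -/(mw w); set n := mw w.
have := @runs_loop tX c (q (size w)) n (fun=> cw w) (fun=> pos w i n)
  (fun j => flatten [seq e w i l | l <- iota (n - j) j] ++ o) isT.
rewrite put_pos_X subnn; apply=> // [_|]; first exact: size_contentsX.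
move=> j jn; have -> : put (pos w i n) tX (n - j) = pos w i (n - j.+1).
  by rewrite -[RHS](put_pos_X w i n) -subSn // subSS.
rewrite iota_down // [flatten (map _ (_ :: _))]/= -catA.
by apply: h => //=; rewrite /n in jn *; lia.
Qed.

Lemma inrange_le b i N : inrange b i N -> i <= N.
Proof. by case: b => [/ltnW|/eqP->]. Qed.

(** With a single mark for [u] this prints the head position in unary, the form in which numbers
    occur in codes. *)
Lemma emit_before_in bi bl u : emittable bi bl (fun _ i _ => flatten (nseq i u)).
Proof.
exists (before tin (print u)), (fun n => n * (2 * size u + 11) + 5); split.
  by apply: poly_add (poly_const 5); apply: poly_mul poly_id (poly_const _).
move=> w i l o /inrange_le wi wl.
apply: (@runs_le _ _ _ (i * (2 * size u + 11) + 5)); first by rewrite leq_add2r leq_mul2r wi orbT.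
apply: runs_before => //; rewrite ?pos_in ?pos_Y ?size_contentsY //; last exact: print_emits.
by apply: leq_trans wi (ltnW (msize_gt _)).
Qed.

Lemma emit_before_X bi bl u : emittable bi bl (fun _ _ l => flatten (nseq l u)).
Proof.
exists (before tX (print u)), (fun n => msize n * (2 * size u + 11) + 5); split.
  by apply: poly_add (poly_const 5); apply: poly_mul (poly_pow _ _) (poly_const _).
move=> w i l o wi /inrange_le wl.
apply: (@runs_le _ _ _ (l * (2 * size u + 11) + 5)); first by rewrite leq_add2r leq_mul2r wl orbT.
by apply: runs_before => //; rewrite ?pos_X ?pos_Y ?size_contentsX ?size_contentsY //; apply: print_emits.
Qed.

Lemma emit_after_X bi u : emittable bi true (fun w _ l => flatten (nseq (mw w - l.+1) u)).
Proof.
exists (after tX (print u)), (fun n => msize n * (2 * size u + 11) + 5); split.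
  by apply: poly_add (poly_const 5); apply: poly_mul (poly_pow _ _) (poly_const _).
move=> w i l o wi /= wl.
apply: (@runs_le _ _ _ ((mw w - l.+1) * (2 * size u + 11) + 5)).
  by rewrite leq_add2r leq_mul2r leq_subr orbT.
have := @runs_after tX (print u) u (2 * size u) (cw w) (pos w i l) o l.
rewrite size_contentsX pos_X pos_Y; apply=> //; exact: print_emits.
Qed.

Lemma emittable_polytime F :
  emittable false false (fun w _ _ => F w) -> polytime F.
Proof.
move=> [c [q [qp h]]].
(* Both counters are brought to [msize c0 e0 (size w)] before printing; the last move puts the
   output head on the first printed bit. *)
pose M := mseq setup (mseq (marks c0.+1) (mseq (power e0.+1) (mseq c (goto tout MoveR)))).
have [r rp hr] : exists2 r, poly_bounded r & forall w, exists f,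
    runs M (init_env w) f (r (size w)) /\
    bit_prefix (scanned (f ord_max) :: right (f ord_max)) = F w.
  pose T n := 30 * e0.+2 * (c0.+1 * n.+1 ^ e0.+2 + n.+1).
  exists (fun n => 3 * n + 8 + (2 * c0.+1 + (T n + (q n + 1).+1).+1).+1 + 1).
    apply: poly_add (poly_const 1); apply: poly_add.
      by apply: poly_add (poly_const 8); apply: poly_mul (poly_const _) poly_id.
    have polyS g : poly_bounded g -> poly_bounded (fun n => (g n).+1).
      by move=> gp; case: (poly_add gp (poly_const 1)) => a [b ab]; exists a, b => n; rewrite -addn1.
    apply: (polyS (fun n => _)); apply: poly_add (poly_const _) _.
    apply: (polyS (fun n => _)); apply: poly_add.
      apply: poly_mul (poly_const _) _; apply: poly_add; first exact: poly_pow.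
      by exists 1, 1 => n; rewrite mul1n.
    by apply: (polyS (fun n => _)); apply: poly_add qp (poly_const 1).
  move=> w.
  have [t [le pw]] := @runs_power e0.+1 w c0.+1 0 [::] (leq0n _).
  have hF := h w (size w) (mw w) [::] (eqxx _) (eqxx _).
  rewrite cats0 in hF.
  have eE o : est w (size w) (mw w) o = stc w (mw w) (mw w) o.
    rewrite /est /stc -/(cw w); congr st.
    by rewrite /pos (@put_id _ (home (cw w)) tin) // put_id // /home size_contentsX.
  rewrite !eE in hF.
  eexists; split.
    rewrite addn1; apply: runs_seq (runs_setup w) _.
    apply: runs_seq (runs_marks c0.+1 w 0 0 [::]) _; rewrite add0n.
    apply: runs_le (runs_seq pw (runs_seq hF (runs_prim _ _ _ _))).
    by rewrite ltnS leq_add2r.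
  rewrite /upd /= /stc /st /=.
  case: (F w) => [|b u] //=; congr cons; rewrite -[map _ u]cats0.
  by elim: u => //= b' u ->.
have [a [d ad]] := poly_boundedW rp.
exists (to_TM M), a, d; apply: (@runs_computes _ _ (fun n => a * n ^ d + a)) => w.
have [f [run out]] := hr w; exists f; split=> //.
by apply: runs_le run; apply: ad.
Qed.

End Emit.

(** * Binary counters *)

Definition bit (n l : nat) : bool := odd (n %/ 2 ^ l).

Lemma bit0 n : bit n 0 = odd n.
Proof. by rewrite /bit divn1. Qed.

Lemma bitS n l : bit n l.+1 = bit n./2 l.
Proof. by rewrite /bit expnS divnMA divn2. Qed.

Lemma bit_zero l : bit 0 l = false.
Proof. by rewrite /bit div0n. Qed.

Lemma bit_small n m l : n < 2 ^ m -> m <= l -> bit n l = false.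
Proof.
move=> lt le; rewrite /bit divn_small //; apply: leq_trans lt _.
by rewrite leq_exp2l.
Qed.

Lemma bit_inj m n n' : n < 2 ^ m -> n' < 2 ^ m ->
  (forall l, l < m -> bit n l = bit n' l) -> n = n'.
Proof.
elim: m n n' => [|m IH] n n' /=; first by case: n; case: n'.
rewrite !expnS => lt lt' e.
rewrite -(odd_double_half n) -(odd_double_half n'); congr (_ + _.*2).
  by have := e 0 isT; rewrite !bit0 => ->.
apply: IH => [||l lm]; [lia | lia |].
by rewrite -!bitS; apply: e.
Qed.

Definition carry (j n : nat) : Prop := (forall l, l < j -> bit n l) /\ ~~ bit n j.

Lemma carry_exists n : exists j, carry j n.
Proof.
elim/ltn_ind: n => n IH; case: (boolP (odd n)) => on; last first.
  by exists 0; split=> //; rewrite bit0.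
have [|j [h1 h2]] := IH n./2; first by lia.
exists j.+1; split; last by rewrite bitS.
by case=> [|l] lj; rewrite ?bit0 // bitS; apply: h1.
Qed.

Lemma bit_succ j n l : carry j n ->
  bit n.+1 l = if l < j then false else if l == j then true else bit n l.
Proof.
elim: j n l => [|j IH] n l [h1 h2].
  rewrite bit0 in h2; case: l => [|l]; first by rewrite bit0 /= h2.
  by rewrite !bitS /= uphalf_half (negPf h2).
have on : odd n by rewrite -bit0; apply: h1.
case: l => [|l]; first by rewrite bit0 /= on.
rewrite !bitS /= uphalf_half on (IH n./2 l) //.
by split=> [i ij|]; rewrite -bitS //; apply: h1.
Qed.

Lemma carry_lt m j n : carry j n -> n.+1 < 2 ^ m -> j < m.
Proof.
move=> cj lt; rewrite ltnNge; apply/negP => mj.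
by have := bit_small lt mj; rewrite (bit_succ j cj) ltnn eqxx.
Qed.

(** A carry that stops below [m] finds a zero among the [m] bits, so the increment cannot
    overflow. *)
Lemma carry_small m j n : carry j n -> j < m -> n < 2 ^ m -> n.+1 < 2 ^ m.
Proof.
move=> cj jm lt; rewrite ltn_neqAle lt andbT; apply/eqP => e.
have := bit_succ m cj; rewrite e ltnNge (ltnW jm) /= gtn_eqF // (bit_small lt) //.
by rewrite /bit divnn expn_gt0.
Qed.

Definition borrow (j n : nat) : Prop := (forall l, l < j -> ~~ bit n l) /\ bit n j.

(** A decrement is an increment read backwards: the borrow out of [n'.+1] stops where the carry into
    it stopped. *)
Lemma borrow_carry j n : borrow j n -> exists2 n', n = n'.+1 & carry j n'.
Proof.
case: n => [|n] [h1 h2]; first by rewrite bit_zero in h2.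
exists n => //; have [i ci] := carry_exists n.
suff -> : j = i by [].
have [ij|ji|//] := ltngtP i j.
- by have := h1 _ ij; rewrite (bit_succ i ci) ltnn eqxx.
- by move: h2; rewrite (bit_succ j ci) ji.
Qed.

(** * Datalog with two counters *)

Inductive body (N : Type) :=
| BN of N | BZero | BMeet of body N & body N | BTest of body N.
Arguments BZero {N}.

Inductive cop := Tinc | Rinc | Rdec.

Definition copn (i : cop) : nat := match i with Tinc => 0 | Rinc => 1 | Rdec => 2 end.

Definition rule (N : Type) : Type := N * option cop * body N.

Definition cop_rel (m : nat) (o : option cop) (t r t' r' : nat) : Prop :=
  match o with
  | None => t' = t /\ r' = r
  | Some Tinc => [/\ t' = t.+1, r' = r & t' < 2 ^ m]
  | Some Rinc => [/\ t' = t, r' = r.+1 & r' < 2 ^ m]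
  | Some Rdec => t' = t /\ r = r'.+1
  end.

(** [BMeet] asks for equal times but keeps only the first [r], so that facts about different cells
    at one time can be combined; [BTest] pins [r] to 0 where the forgotten value matters. *)
Inductive prov (N : Type) (m : nat) (P : seq (rule N)) : body N -> nat -> nat -> Prop :=
| prov_rule k o b t r t' r' : List.In (k, o, b) P -> prov m P b t r ->
    cop_rel m o t r t' r' -> prov m P (BN k) t' r'
| prov_zero : prov m P BZero 0 0
| prov_meet a b t r r' : prov m P a t r -> prov m P b t r' -> prov m P (BMeet a b) t r
| prov_test a t : prov m P a t 0 -> prov m P (BTest a) t 0.

(** * Automata *)

Definition err : 'I_3 := @Ordinal 3 2 isT.
Definition bv (b : bool) : 'I_3 := if b then @Ordinal 3 1 isT else ord0.

Lemma bv_inj : injective bv.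
Proof. by case=> -[]. Qed.

Lemma bv_er b : (bv b == err) = false.
Proof. by case: b. Qed.

Definition flip (b b' : bool) (x : 'I_3) : 'I_3 := if x == bv b then bv b' else err.

(* [c] says whether the automaton tracks a bit of [t] or a bit of [r]. *)
Definition meet (c : bool) (x y : 'I_3) : 'I_3 :=
  if c then if x == y then x else err else if y == err then err else x.

Definition test (c : bool) (x : 'I_3) : 'I_3 := if c then x else flip false false x.

(* [i] is 0, 1, 2 for [t + 1], [r + 1], [r - 1]; the carry stops at a position
   [below] or [above] the bit of the automaton, or at that bit. *)
Definition count_op (c : bool) (i : nat) (below above : bool) (x : 'I_3) : 'I_3 :=
  if (i == 0) != c then x else
  if below then x else
  if above then flip (i != 2) (i == 2) x else flip (i == 2) (i != 2) x.

(** From 3 on, the symbol number packs a bit position and one of the three counter operations, in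
    base 3. Each operation sends [err] in an argument to [err], so an error anywhere in a ground
    term reaches its root. *)
Definition interp (c : bool) (l f : nat) (s : seq 'I_3) : 'I_3 :=
  match f with
  | 0 => bv false
  | 1 => meet c (nth err s 0) (nth err s 1)
  | 2 => test c (nth err s 0)
  | f.+3 => count_op c (f %% 3) (f %/ 3 < l) (l < f %/ 3) (nth err s 0)
  end.

(** The joint state of all automata at one node of the term. Only entries below [m] are looked at by
    [represents] and [faulty]. *)
Definition vec := bool -> nat -> 'I_3.

Definition vop (f : nat) (s : seq vec) : vec := fun c l => interp c l f [seq v c l | v <- s].

Section Automata.
Variable m : nat.

Definition represents (v : vec) (t r : nat) : Prop :=
  [/\ t < 2 ^ m, r < 2 ^ m & forall l, l < m -> v true l = bv (bit t l) /\ v false l = bv (bit r l)].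

Definition faulty (v : vec) : Prop := exists c l, l < m /\ v c l = err.

Lemma vop_zero : represents (vop 0 [::]) 0 0.
Proof. by split=> [||l lm]; rewrite ?expn_gt0 // /vop /interp bit_zero. Qed.

Lemma vop_meet_complete v1 v2 t r r' :
  represents v1 t r -> represents v2 t r' -> represents (vop 1 [:: v1; v2]) t r.
Proof.
move=> [tm rm h1] [_ _ h2]; split=> // l lm; rewrite /vop /=.
have [-> ->] := h1 l lm; have [-> ->] := h2 l lm.
by rewrite eqxx bv_er.
Qed.

(** Two different times differ in one of their [m] bits, and the automaton of that bit goes to the
    error state. *)
Lemma vop_meet_sound v1 v2 :
  (faulty v1 \/ exists t r, represents v1 t r) ->
  (faulty v2 \/ exists t r, represents v2 t r) ->
  ~ faulty (vop 1 [:: v1; v2]) ->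
  exists t r r', [/\ represents v1 t r, represents v2 t r' & represents (vop 1 [:: v1; v2]) t r].
Proof.
move=> h1 h2 nf; case: h1 => [[c [l [lm e]]]|[t [r h1]]].
  case: nf; exists c, l; split=> //; rewrite /vop /= e /meet; case: c {e} => //.
    by case: ifP.
  by case: ifP.
case: h2 => [[c [l [lm e]]]|[t' [r' h2]]].
  case: nf; exists c, l; split=> //; rewrite /vop /= e /meet; case: c {e}; rewrite ?eqxx //.
  by case: eqP => // ->.
have tt : t = t'.
  have [t1 _ hh1] := h1; have [t2 _ hh2] := h2.
  apply: (bit_inj t1 t2) => l lm; apply: bv_inj; apply/eqP/negPn/negP => ne.
  case: nf; exists true, l; split=> //; rewrite /vop /=.
  by have [-> _] := hh1 l lm; have [-> _] := hh2 l lm; rewrite (negPf ne).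
exists t, r, r'; rewrite -tt in h2; split=> //; exact: vop_meet_complete h2.
Qed.

Lemma vop_test_complete v t : represents v t 0 -> represents (vop 2 [:: v]) t 0.
Proof.
move=> [tm rm h]; split=> // l lm; rewrite /vop /=.
by have [-> ->] := h l lm; rewrite bit_zero.
Qed.

Lemma vop_test_sound v :
  (faulty v \/ exists t r, represents v t r) -> ~ faulty (vop 2 [:: v]) ->
  exists t, represents v t 0 /\ represents (vop 2 [:: v]) t 0.
Proof.
move=> h nf; case: h => [[c [l [lm e]]]|[t [r h]]].
  by case: nf; exists c, l; split=> //; rewrite /vop /= e; case: c {e}.
have r0 : r = 0.
  have [_ rm hh] := h.
  apply: (bit_inj rm) => [|l lm]; first by rewrite expn_gt0.
  rewrite bit_zero; apply/negP => br.
  by case: nf; exists false, l; split=> //; rewrite /vop /=; have [_ ->] := hh l lm; rewrite br.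
by rewrite r0 in h; exists t; split=> //; apply: vop_test_complete.
Qed.

Definition fcop (i : cop) (l : nat) : nat := (l * 3 + copn i).+3.

Lemma vop_cop i j v : vop (fcop i j) [:: v] =
  fun c l => count_op c (copn i) (j < l) (l < j) (v c l).
Proof.
apply: functional_extensionality => c; apply: functional_extensionality => l.
have i3 : copn i < 3 by case: i.
by rewrite /vop /= divnMDl // modnMDl divn_small // addn0 modn_small.
Qed.

Lemma inc_complete j n l : carry j n ->
  (if j < l then bv (bit n l) else if l < j then flip true false (bv (bit n l))
   else flip false true (bv (bit n l))) = bv (bit n.+1 l).
Proof.
move=> cj; rewrite (bit_succ _ cj); have [h1 h2] := cj.
by have [lj|lj|<-] := ltngtP j l; [| rewrite h1 | rewrite (negPf h2)].
Qed.

Lemma dec_complete j n l : carry j n ->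
  (if j < l then bv (bit n.+1 l) else if l < j then flip false true (bv (bit n.+1 l))
   else flip true false (bv (bit n.+1 l))) = bv (bit n l).
Proof.
move=> cj; rewrite (bit_succ _ cj); have [h1 h2] := cj.
by have [lj|lj|<-] := ltngtP j l; [| rewrite h1 | rewrite (negPf h2)].
Qed.

Lemma vop_cop_complete i v t r t' r' : represents v t r -> cop_rel m (Some i) t r t' r' ->
  exists2 j, j < m & represents (vop (fcop i j) [:: v]) t' r'.
Proof.
move=> [tm rm h]; case: i => /= [[-> -> lt]|[-> -> lt]|[-> e]].
- have [j cj] := carry_exists t; exists j; first exact: carry_lt cj lt.
  split=> // l lm; rewrite vop_cop; have [-> ->] := h l lm.
  by split=> //; apply: inc_complete.
- have [j cj] := carry_exists r; exists j; first exact: carry_lt cj lt.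
  split=> // l lm; rewrite vop_cop; have [-> ->] := h l lm.
  by split=> //; apply: inc_complete.
- rewrite e in rm h; have [j cj] := carry_exists r'; exists j; first exact: carry_lt cj rm.
  split=> [//||l lm]; first by lia.
  rewrite vop_cop; have [-> ->] := h l lm.
  by split=> //; apply: dec_complete.
Qed.

(** If no automaton at a position up to [j] fails, its bit has the value that [flip] expects there.
    Hence [j] is the true carry or borrow position, and [j < m] excludes overflow. *)
Lemma vop_cop_sound i j v : j < m ->
  (faulty v \/ exists t r, represents v t r) -> ~ faulty (vop (fcop i j) [:: v]) ->
  exists t r t' r', [/\ represents v t r, cop_rel m (Some i) t r t' r' &
    represents (vop (fcop i j) [:: v]) t' r'].
Proof.
move=> jm h; rewrite vop_cop => nf; case: h => [[c [l [lm e]]]|[t [r h]]].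
  case: nf; exists c, l; split=> //; rewrite e /count_op /flip.
  by do 3?case: ifP => // _; case: i.
have [tm rm hh] := h.
have ok c l : l < m -> count_op c (copn i) (j < l) (l < j) (v c l) <> err.
  by move=> lm e; apply: nf; exists c, l.
exists t, r; case: i {nf} ok => /= ok.
- have cj : carry j t.
    split=> [l lj|].
      have lm := ltn_trans lj jm; have := ok true l lm; rewrite /count_op /= lj ltnNge (ltnW lj) /=.
      by have [-> _] := hh l lm; case: bit.
    by have := ok true j jm; rewrite /count_op /= ltnn; have [-> _] := hh j jm; case: bit.
  have lt := carry_small cj jm tm.
  exists t.+1, r; split=> //; split=> // l lm; have [-> ->] := hh l lm.
  by split=> //; apply: inc_complete.
- have cj : carry j r.
    split=> [l lj|].
      have lm := ltn_trans lj jm; have := ok false l lm; rewrite /count_op /= lj ltnNge (ltnW lj) /=.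
      by have [_ ->] := hh l lm; case: bit.
    by have := ok false j jm; rewrite /count_op /= ltnn; have [_ ->] := hh j jm; case: bit.
  have lt := carry_small cj jm rm.
  exists t, r.+1; split=> //; split=> // l lm; have [-> ->] := hh l lm.
  by split=> //; apply: inc_complete.
- have : borrow j r.
    split=> [l lj|].
      have lm := ltn_trans lj jm; have := ok false l lm; rewrite /count_op /= lj ltnNge (ltnW lj) /=.
      by have [_ ->] := hh l lm; case: bit.
    by have := ok false j jm; rewrite /count_op /= ltnn; have [_ ->] := hh j jm; case: bit.
  case/borrow_carry => r' e cj; rewrite e in rm hh.
  exists t, r'; split=> //; split=> [//||l lm]; first by lia.
  have [-> ->] := hh l lm.
  by split=> //; apply: dec_complete.
Qed.

End Automata.

(** * Derivations of regular tree grammars *)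

Section TreeFacts.
Variables (S : Type) (rank : S -> nat).

Fixpoint tree_nested_ind (N : Type) (Q : tree rank N -> Prop) (hNT : forall B, Q (NT rank B))
  (hNode : forall s (ts : (tree rank N ^ rank s)%type), (forall i, Q (ts i)) -> Q (Node ts)) t : Q t :=
  match t with
  | NT B => hNT B
  | Node s ts => hNode s ts (fun i => tree_nested_ind hNT hNode (ts i))
  end.

Variable G : grammar rank.
Notation T := (tree rank 'I_(nnt G)).
Notation rewrites_star := (clos_refl_trans_1n _ (@rewrites _ rank G)).

Lemma star_trans (t u v : T) : rewrites_star t u -> rewrites_star u v -> rewrites_star t v.
Proof. by elim=> // x y z xy _ IH /IH; apply: rt1n_trans. Qed.

Lemma star_child s (ts : (T ^ rank s)%type) i u : rewrites_star (ts i) u ->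
  rewrites_star (Node ts) (Node [ffun j => if j == i then u else ts j]).
Proof.
move: {-1}(ts i) (erefl (ts i)) => x ex h; elim: h ts ex => [y|y z u' yz _ IH] ts ex.
  have -> : [ffun j => if j == i then y else ts j] = ts; last exact: rt1n_refl.
  by apply/ffunP=> j; rewrite ffunE; case: eqP => [->|].
rewrite -ex in yz; apply: (rt1n_trans _ _ _ _ _ (rewrites_child yz)).
have := IH [ffun j => if j == i then z else ts j]; rewrite ffunE eqxx => /(_ erefl).
by congr clos_refl_trans_1n; congr Node; apply/ffunP=> j; rewrite !ffunE; case: eqP.
Qed.

Lemma star_node s (ts ts' : (T ^ rank s)%type) :
  (forall i, rewrites_star (ts i) (ts' i)) -> rewrites_star (Node ts) (Node ts').
Proof.
move=> h.
(* One rewriting step touches one child, so the children are treated one after another; [r] lists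
   those already done. *)
suff H (r : seq 'I_(rank s)) : rewrites_star (Node ts) (Node [ffun j => if j \in r then ts' j else ts j]).
  have := H (enum 'I_(rank s)); congr clos_refl_trans_1n; congr Node.
  by apply/ffunP=> j; rewrite ffunE mem_enum.
elim: r => [|i r IH].
  have -> : [ffun j => if j \in [::] then ts' j else ts j] = ts; last exact: rt1n_refl.
  by apply/ffunP=> j; rewrite ffunE.
apply: star_trans IH _.
have := @star_child s [ffun j => if j \in r then ts' j else ts j] i (ts' i).
rewrite ffunE.
have -> : [ffun j => if j == i then ts' i else [ffun j0 => if j0 \in r then ts' j0 else ts j0] j]
  = [ffun j => if j \in i :: r then ts' j else ts j].
  by apply/ffunP=> j; rewrite !ffunE inE; case: eqP => [->|].
apply; case: ifP => _; [exact: rt1n_refl | exact: h].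
Qed.
End TreeFacts.

(** * The realizability instance of a Datalog program *)

Section Instance.
Variables (k m : nat) (N : Type) (nN : nat) (idx : N -> 'I_nN).
Hypothesis idx_inj : injective idx.
Variables (P : seq (rule N)) (Ax Acc : N).

(** The arities follow the numbering of [interp]: zero, meet, test, then three counter operations
    per bit position. *)
Definition tau := Signature [:: 1] [:: 0, 2, 1 & nseq (m * 3) 1].

Definition farity (f : nat) : nat := nth 0 [:: 0, 2, 1 & nseq (m * 3) 1] f.

Definition fsymb (f : nat) : Defs.fsym tau := inord f.

Lemma fsymbE f : f < m * 3 + 3 -> fsymb f = f :> nat.
Proof. move=> lt; apply: inordK; apply: leq_trans lt _.
have -> : m * 3 + 3 = size (fun_ars tau) by rewrite addnC -{1}(size_nseq (m * 3) 1).
exact: leqnn. Qed.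

Lemma far_fsymb f : f < m * 3 + 3 -> far (fsymb f) = farity f.
Proof. by move=> lt; rewrite /far fsymbE. Qed.

Lemma farity_cop f : f < m * 3 -> farity f.+3 = 1.
Proof. by move=> lt; rewrite /farity /= nth_nseq lt. Qed.

Notation TT := (fo_tree k tau 'I_nN).
Variable B0 : 'I_nN.

(** Symbols are plain numbers, and the arity of [fsymb f] agrees with [size s] only up to a provable
    equality. The children are therefore read by [nth], whose default [B0] is never reached when the
    arity fits. *)
Definition app (f : nat) (s : seq TT) : TT :=
  @Node _ _ _ (SFun k (fsymb f)) [ffun i : 'I_(far (fsymb f)) => nth (NT _ B0) s i].

Fixpoint btree (b : body N) : TT :=
  match b with
  | BN B => NT _ (idx B)
  | BZero => app 0 [::]
  | BMeet a b => app 1 [:: btree a; btree b]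
  | BTest a => app 2 [:: btree a]
  end.

Definition rtree (l : nat) (r : rule N) : 'I_nN * TT :=
  let: (B, o, b) := r in
  (idx B, if o is Some i then app (fcop i l) [:: btree b] else btree b).

Definition top (u : TT) : TT := @Node _ _ _ (SRel k (ord0 : rsym tau)) [ffun=> u].

(* Rules without counter operation are repeated for every bit position [l]; the
   repetition keeps the grammar printable by a single loop. *)
Definition datalog_grammar : fo_grammar k tau :=
  @Grammar _ _ nN (idx Ax) ((idx Ax, top (NT _ (idx Acc))) ::
    flatten [seq [seq rtree l r | r <- P] | l <- iota 0 m]).

Definition sop (s : fo_sym k tau) (vs : seq vec) : vec :=
  match s with
  | SFun f => vop f vs
  | SRel _ => nth (fun _ _ => err) vs 0
  | _ => fun _ _ => err
  end.

Fixpoint tree_vec (t : TT) : vec :=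
  match t with
  | NT _ => fun _ _ => err
  | Node s ts => sop s [tuple tree_vec (ts i) | i < fo_rank s]
  end.

Definition factual (s : fo_sym k tau) : bool :=
  match s with SFun _ | SRel _ => true | _ => false end.

(** Nonterminals count as pure because this is an invariant of derivations. It confines the
    sentences of the language to atoms without variables or if-then-else, whose truth is decided by
    [tree_vec]. *)
Fixpoint pure (t : TT) : bool :=
  match t with
  | NT _ => true
  | Node s ts => factual s && [forall i, pure (ts i)]
  end.

Fixpoint fpure (t : TT) : bool :=
  match t with
  | NT _ => false
  | Node s ts => (if s is SFun _ then true else false) && [forall i, fpure (ts i)]
  end.

Definition automaton (c : bool) (l : nat) : structure tau :=
  @Structure tau 2
    (fun r => [ffun u : (rar r).-tuple 'I_3 => nth err u 0 != err])
    (fun f => [ffun u : (far f).-tuple 'I_3 => interp c l f u]).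

Definition datalog_instance : instance k :=
  @Instance k tau (flatten [seq [:: automaton true l; automaton false l] | l <- iota 0 m])
    [::] datalog_grammar.

Lemma map_mktuple T U n (f : T -> U) (g : 'I_n -> T) :
  [seq f x | x <- [tuple g i | i < n]] = [tuple f (g i) | i < n].
Proof. by rewrite -map_comp. Qed.

Lemma nth_ord_image0 T n (d : T) (F : 'I_n -> T) (i : 'I_n) :
  i = 0 :> nat -> nth d [seq F i | i <- enum 'I_n] 0 = F i.
Proof. by move=> <-; rewrite (nth_map i) ?size_enum_ord // nth_ord_enum. Qed.

Section Eval.
Variables (c : bool) (l : nat) (v : valuation k (automaton c l)).

Fixpoint eval_tree_vec (t : term k tau) : pure (term_tree 'I_nN t) ->
   eval v t = tree_vec (term_tree 'I_nN t) c l.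
Proof.
case: t => [x|f ts|p t1 t2] //= /forallP h.
rewrite ffunE /vop map_mktuple; congr interp; congr val.
apply: eq_from_tnth => i; rewrite !tnth_mktuple ffunE; apply: eval_tree_vec.
by have := h i; rewrite ffunE.
Qed.

Lemma sat_tree_vec (p : formula k tau) : pure (formula_tree 'I_nN p) ->
  sat v p = (tree_vec (formula_tree 'I_nN p) c l != err).
Proof.
case: p => [r ts|||||] //= /forallP h.
rewrite ffunE.
have lt : 0 < rar r by rewrite [r]ord1.
rewrite !(@nth_ord_image0 _ _ _ _ (Ordinal lt)) // ffunE.
congr (_ != _); apply: eval_tree_vec; have := h (Ordinal lt); rewrite ffunE; apply.
Qed.
End Eval.


(** * Soundness: from a realizing sentence to a Datalog proof *)

Definition with_axiom : seq (rule N) := (Ax, None, BN Acc) :: P.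

Definition fact (B : 'I_nN) (v : vec) : Prop :=
  faulty m v \/ exists t r n, [/\ represents m v t r, idx n = B & prov m with_axiom (BN n) t r].

(** A relation rather than a function, because a nonterminal stands for many facts: [v] is a value
    of [u] for some choice of a provable fact, or of a faulty vector, at every nonterminal leaf. The
    root symbol passes its argument on, so that the axiom rule acts as the extra Datalog rule of
    [with_axiom]. *)
Fixpoint sem (u : TT) (v : vec) : Prop :=
  match u with
  | NT B => fact B v
  | Node s ts => exists vs : 'I_(fo_rank s) -> vec,
      (forall i, sem (ts i) (vs i)) /\ v = sop s [tuple vs i | i < fo_rank s]
  end.

Lemma sem_app f s v : f < m * 3 + 3 -> farity f = size s -> sem (app f s) v ->
  exists vs, [/\ size vs = size s, v = vop f vs &
    forall i, i < size s -> sem (nth (NT _ B0) s i) (nth (fun _ _ => err) vs i)].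
Proof.
move=> lt ar [vs [h ->]]; exists [seq vs i | i <- enum 'I_(fo_rank (SFun k (fsymb f)))].
have ar' : fo_rank (SFun k (fsymb f)) = size s by rewrite /= far_fsymb.
split; [by rewrite size_map size_enum_ord | by congr (vop _); apply: fsymbE |].
move=> i; rewrite -ar' => lti; have := h (Ordinal lti); rewrite ffunE.
by rewrite (nth_map (Ordinal lti)) ?size_enum_ord // (nth_ord_enum (Ordinal lti) (Ordinal lti)).
Qed.

Lemma faulty_em v : faulty m v \/ ~ faulty m v.
Proof.
case: (boolP [exists c : bool, [exists l : 'I_m, v c l == err]]) => [|h].
  by case/existsP=> c /existsP[l /eqP e]; left; exists c, l.
right=> -[c [l [lm e]]]; case/existsP: h; exists c; apply/existsP; exists (Ordinal lm).
exact/eqP.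
Qed.

Lemma represents_inj v t r t' r' : represents m v t r -> represents m v t' r' -> t = t' /\ r = r'.
Proof.
move=> [tm rm h] [tm' rm' h']; split; [apply: (bit_inj tm tm') | apply: (bit_inj rm rm')].
  by move=> l lm; apply: bv_inj; have [<- _] := h l lm; have [<- _] := h' l lm.
by move=> l lm; apply: bv_inj; have [_ <-] := h l lm; have [_ <-] := h' l lm.
Qed.

Definition means (Q : nat -> nat -> Prop) v : Prop :=
  faulty m v \/ exists t r, represents m v t r /\ Q t r.

Lemma means_weak Q v : means Q v -> faulty m v \/ exists t r, represents m v t r.
Proof. by case=> [|[t [r []]]]; [left | right; exists t, r]. Qed.

Lemma means_eq Q v t r : represents m v t r -> ~ faulty m v -> means Q v -> Q t r.
Proof. by move=> h nf [//|[t' [r' [/(represents_inj h)[-> ->]]]]]. Qed.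

Lemma represents_fine v t r : represents m v t r -> ~ faulty m v.
Proof.
move=> [_ _ h] [c [l [lm e]]]; have [h1 h2] := h l lm.
have : exists b, v c l = bv b by case: c {e}; rewrite ?h1 ?h2; eexists.
by rewrite e => -[b /esym/eqP]; rewrite bv_er.
Qed.

Lemma sem_btree b v : sem (btree b) v -> means (prov m with_axiom b) v.
Proof.
elim: b v => [n||a IHa b IHb|a IHa] v.
- case=> [|[t [r [n' [h /idx_inj-> p]]]]]; first by left.
  by right; exists t, r.
- case/sem_app=> //; first by lia.
  move=> [|? ?] [] // _ -> _; right; exists 0, 0; split; [exact: vop_zero | exact: prov_zero].
- case/sem_app=> //; first by lia.
  move=> [|v1 [|v2 [|? ?]]] [] // _ -> h.
  have h1 := IHa _ (h 0 isT); have h2 := IHb _ (h 1 isT).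
  have [|nf] := faulty_em (vop 1 [:: v1; v2]); first by left.
  have [t [r [r' [r1 r2 r3]]]] := vop_meet_sound (means_weak h1) (means_weak h2) nf.
  right; exists t, r; split=> //.
  apply: prov_meet (means_eq r1 (represents_fine r1) h1) (means_eq r2 (represents_fine r2) h2).
- case/sem_app=> //; first by lia.
  move=> [|v1 [|? ?]] [] // _ -> h.
  have h1 := IHa _ (h 0 isT).
  have [|nf] := faulty_em (vop 2 [:: v1]); first by left.
  have [t [r1 r2]] := vop_test_sound (means_weak h1) nf.
  right; exists t, 0; split=> //; apply: prov_test.
  exact: means_eq r1 (represents_fine r1) h1.
Qed.

Lemma In_map T U (f : T -> U) y s :
  List.In y (map f s) <-> exists2 x, f x = y & List.In x s.
Proof.
elim: s => [|x s IH] /=; first by split=> // -[].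
split=> [[e|/IH[z ? ?]]|[z e [ez|zs]]]; [by exists x; auto | by exists z; auto | |].
  by left; rewrite ez.
by right; apply/IH; exists z.
Qed.

Lemma In_flatten T (x : T) ss :
  List.In x (flatten ss) <-> exists2 s, List.In x s & List.In s ss.
Proof.
elim: ss => [|s ss IH] /=; first by split=> // -[].
rewrite -/(flatten ss); split.
  move/(List.in_app_or s (flatten ss)) => [h|/IH[s' ? ?]]; [by exists s; auto | by exists s'; auto].
move=> h; apply: (List.in_or_app s (flatten ss)).
by case: h => s' xs' [e|h]; [left; rewrite e | right; apply/IH; exists s'].
Qed.

Lemma In_mem (T : eqType) (x : T) s : List.In x s <-> x \in s.
Proof.
elim: s => [|y s IH] //=; rewrite inE; split.
  by case=> [->|/IH->]; rewrite ?eqxx ?orbT.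
by case/orP=> [/eqP->|/IH]; auto.
Qed.

Lemma In_datalog_rules B u : List.In (B, u) (rules datalog_grammar) <->
  (B, u) = (idx Ax, top (NT _ (idx Acc))) \/
  exists l r, [/\ l < m, List.In r P & (B, u) = rtree l r].
Proof.
split.
  case=> [<-|/In_flatten[s /[swap] /In_map[l <- /In_mem]]]; first by left.
  rewrite mem_iota => lm /In_map[r e rP]; right; exists l, r.
  by split; [exact: lm | | rewrite e].
case=> [->|[l [r [lm rP ->]]]]; first by left.
right; apply/In_flatten; exists [seq rtree l r | r <- P].
  by apply/In_map; exists r.
by apply/In_map; exists l => //; apply/In_mem; rewrite mem_iota.
Qed.

Lemma fcop_lt i l : l < m -> fcop i l < m * 3 + 3.
Proof. by rewrite /fcop; case: i => /=; lia. Qed.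

Lemma farity_fcop i l : l < m -> farity (fcop i l) = 1.
Proof. by move=> lm; rewrite /fcop farity_cop //; case: i => /=; lia. Qed.

Lemma rules_sem B u v : List.In (B, u) (rules datalog_grammar) -> sem u v -> fact B v.
Proof.
case/In_datalog_rules=> [[-> ->]|[l [[[n o] b] [lm rP [-> ->]]]]].
  move=> [vs [h ->]]; have := h ord0; rewrite ffunE /= => fa.
  rewrite (@nth_ord_image0 _ _ _ _ ord0) //.
  case: fa => [|[t [r [n' [h1 /idx_inj e p]]]]]; first by left.
  right; exists t, r, Ax; split=> //; rewrite e in p.
  by apply: (@prov_rule _ _ _ Ax None (BN Acc) t r) p _; [left | split].
case: o rP => [i|] rP; last first.
  case/sem_btree=> [|[t [r [h p]]]]; first by left.
  right; exists t, r, n; split=> //.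
  by apply: (@prov_rule _ _ _ n None b t r) p _; [right | split].
case/sem_app; rewrite ?farity_fcop ?fcop_lt //.
move=> [|v1 [|? ?]] [] // _ -> h.
have h1 := sem_btree (h 0 isT).
have [|nf] := faulty_em (vop (fcop i l) [:: v1]); first by left.
have [t [r [t' [r' [r1 c r2]]]]] := vop_cop_sound lm (means_weak h1) nf.
right; exists t', r', n; split=> //.
apply: (@prov_rule _ _ _ n (Some i) b t r) c; first by right.
exact: means_eq r1 (represents_fine r1) h1.
Qed.

(** A derivation expands nonterminals in any order, so evaluation cannot follow it forwards. Read
    backwards, each step contracts one right-hand side to its nonterminal, which is one application
    of a Datalog rule. *)
Lemma rewrites_sem u u' v : @rewrites _ _ datalog_grammar u u' -> sem u' v -> sem u v.
Proof.
move=> h; elim: h v => [B w wP|s ts i w _ IH] v; first exact: (rules_sem wP).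
move=> [vs [h ->]]; exists vs; split=> // j; have := h j; rewrite ffunE.
by case: eqP => // -> /IH.
Qed.

Lemma pure_app f s : all pure s -> pure (app f s).
Proof.
move=> h; apply/forallP => i; rewrite ffunE.
by have [lt|le] := ltnP i (size s); [apply: all_nthP lt | rewrite nth_default].
Qed.

Lemma pure_btree b : pure (btree b).
Proof.
elim: b => [//||a IHa b IHb|a IHa]; apply: pure_app => //=; by rewrite ?IHa ?IHb.
Qed.

Lemma rewrites_pure u u' : @rewrites _ _ datalog_grammar u u' -> pure u -> pure u'.
Proof.
elim=> [B w|s ts i w _ IH] /=.
  case/In_datalog_rules=> [[_ ->] _|[l [[[n o] b] [_ _ [_ ->]]]] _].
    by apply/forallP => i; rewrite ffunE.
  case: o => [o|]; last exact: pure_btree.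
  by apply: pure_app; rewrite /= pure_btree.
case/andP=> -> /forallP h; apply/forallP => j; rewrite ffunE.
by case: eqP => // _; apply: IH.
Qed.

Lemma sem_tree_vec t : terminal t -> sem t (tree_vec t).
Proof.
elim/tree_nested_ind: t => [//|s ts IH] /= /forallP h.
by exists (fun i => tree_vec (ts i)); split=> // i; apply: IH.
Qed.

Lemma In_Pos c l : l < m -> List.In (automaton c l) (Pos datalog_instance).
Proof.
move=> lm; apply/In_flatten; exists [:: automaton true l; automaton false l].
  by case: c; [left | right; left].
by apply/In_map; exists l => //; apply/In_mem; rewrite mem_iota.
Qed.

Lemma datalog_instance_sound : realizable datalog_instance -> exists t r, prov m with_axiom (BN Ax) t r.
Proof.
case=> p [_ [term star] pos _].
have [pu sm] : pure (formula_tree 'I_nN p) /\ sem (NT _ (idx Ax)) (tree_vec (formula_tree 'I_nN p)).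
  (* The finished tree has its own vector as a value; this is carried back along the derivation to
     the axiom. *)
  have h := sem_tree_vec term.
  have : pure (NT (@fo_rank k tau) (idx Ax)) by [].
  elim: star h => [u|u u' w uu' _ IH] h pu //.
  have [||? ?] := IH _ _; [exact: h | exact: rewrites_pure uu' pu |].
  by split=> //; apply: rewrites_sem uu' _.
case: sm => [[c [l [lm e]]]|[t [r [n [_ /idx_inj-> pr]]]]]; last by exists t, r.
(* A faulty vector names an automaton in the error state, and this positive structure falsifies the
   sentence. *)
have := pos _ (In_Pos c lm) [ffun=> ord0].
by rewrite sat_tree_vec // e eqxx.
Qed.

(** * Completeness: from a Datalog proof to a realizing sentence *)

Lemma tree_vec_app f s : f < m * 3 + 3 -> farity f = size s -> tree_vec (app f s) = vop f (map tree_vec s).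
Proof.
move=> lt ar; rewrite -[vop f]/(vop (f : nat)) -{2}(fsymbE lt); congr (vop _).
have ar' : far (fsymb f) = size s by rewrite far_fsymb.
apply: (@eq_from_nth _ (fun _ _ => err)) => [|i]; first by rewrite size_tuple size_map; apply: ar'.
rewrite size_tuple => lti; rewrite -[i]/(val (Ordinal lti)) nth_mktuple ffunE.
by rewrite (nth_map (NT _ B0)) // -ar'.
Qed.

Lemma fpure_app f s : f < m * 3 + 3 -> farity f = size s -> all fpure s -> fpure (app f s).
Proof.
move=> lt ar h; apply/forallP => i; rewrite ffunE.
by apply: all_nthP h _ _; rewrite -ar -far_fsymb.
Qed.

Lemma star_app f s s' : f < m * 3 + 3 -> farity f = size s ->
  (forall i, i < size s -> clos_refl_trans_1n _ (@rewrites _ _ datalog_grammar) (nth (NT _ B0) s i) (nth (NT _ B0) s' i)) ->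
  clos_refl_trans_1n _ (@rewrites _ _ datalog_grammar) (app f s) (app f s').
Proof.
move=> lt ar h; apply: star_node => i; rewrite !ffunE; apply: h.
by rewrite -ar -far_fsymb.
Qed.

Definition produces (u : TT) t r : Prop :=
  exists T, [/\ clos_refl_trans_1n _ (@rewrites _ _ datalog_grammar) u T, fpure T & represents m (tree_vec T) t r].

Lemma produces_app1 f a t r t' r' : f < m * 3 + 3 -> farity f = 1 ->
  (forall v, represents m v t r -> represents m (vop f [:: v]) t' r') ->
  produces a t r -> produces (app f [:: a]) t' r'.
Proof.
move=> lt ar h [T [st fp rp]]; exists (app f [:: T]); split.
- by apply: star_app => // -[].
- by apply: fpure_app; rewrite /= ?fp.
- by rewrite tree_vec_app //; apply: h.
Qed.

Hypothesis m_gt0 : 0 < m.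

Lemma prov_produces b t r : prov m P b t r -> produces (btree b) t r.
Proof.
elim=> {b t r} [n o b t r t' r' rP _ IH c||a b t r r' _ [T [s1 p1 r1]] _ [T' [s2 p2 r2]]|a t _ IH].
- have [T [st fp rp]] := IH.
  have start l : l < m -> @rewrites _ _ datalog_grammar (NT _ (idx n)) (rtree l (n, o, b)).2.
    by move=> lm; apply: rewrites_root; apply/In_datalog_rules; right; exists l, (n, o, b).
  case: o {rP} c start => [i c|[-> ->]] start; last first.
    (* A rule without counter operation has one copy per bit position; [m_gt0] guarantees that there
       is a copy at all. *)
    by exists T; split=> //; apply: rt1n_trans st; apply: (start 0 m_gt0).
  have [j jm h] := vop_cop_complete rp c.
  exists (app (fcop i j) [:: T]); split.
  + apply: rt1n_trans (start j jm) _.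
    by apply: star_app; rewrite ?farity_fcop ?fcop_lt // => -[].
  + by apply: fpure_app; rewrite ?farity_fcop ?fcop_lt //= fp.
  + by rewrite tree_vec_app ?farity_fcop ?fcop_lt.
- exists (app 0 [::]); split; [exact: rt1n_refl | by apply: fpure_app; rewrite // addn3 |].
  by rewrite tree_vec_app; [exact: vop_zero | lia |].
- exists (app 1 [:: T; T']); split.
  + by apply: star_app; [lia | | case=> [|[|//]]].
  + by apply: fpure_app; [lia | | rewrite /= p1 p2].
  + by rewrite tree_vec_app; [exact: vop_meet_complete r2 | lia |].
- by apply: produces_app1 IH; [lia | | move=> v; apply: vop_test_complete].
Qed.

Lemma fpure_terminal (t : TT) : fpure t -> terminal t.
Proof.
elim/tree_nested_ind: t => [//|s ts IH] /= /andP[_ /forallP h].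
by apply/forallP => i; apply: IH.
Qed.

Lemma fpure_pure (t : TT) : fpure t -> pure t.
Proof.
elim/tree_nested_ind: t => [//|s ts IH] /= /andP[hs /forallP h].
by apply/andP; split; [case: s hs {ts IH h} | apply/forallP => i; apply: IH].
Qed.

(** The certificate is a ground term, so the atom built on it is a sentence for any number of
    variables. *)
Lemma fpure_term (t : TT) : fpure t -> exists u : term k tau,
  term_tree 'I_nN u = t /\ term_fv u = set0.
Proof.
elim/tree_nested_ind: t => [//|s ts IH] /= /andP[hs /forallP h].
case: s hs ts IH h => //= f _ ts IH h.
have [g gP] := fin_all_exists (fun i => IH i (h i)).
exists (@TFun k tau f (finfun g)); split.
  by congr Node; apply/ffunP=> i; rewrite !ffunE; case: (gP i).
apply/setP=> x /=; rewrite inE; apply/bigcupP => -[i _]; rewrite ffunE.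
by case: (gP i) => _ ->; rewrite inE.
Qed.

Lemma datalog_instance_complete t r : prov m P (BN Acc) t r -> realizable datalog_instance.
Proof.
move=> /prov_produces[T [st fp rp]]; have [u [eu fvu]] := fpure_term fp.
pose p := @FRel k tau (ord0 : rsym tau) [ffun=> u].
have ep : formula_tree 'I_nN p = top T.
  by congr Node; apply/ffunP=> i; rewrite !ffunE.
exists p; split=> //.
- apply/setP=> x /=; rewrite inE; apply/bigcupP => -[i _].
  by rewrite ffunE fvu inE.
- rewrite /in_lang ep; split.
    by apply/forallP => i; rewrite ffunE; apply: fpure_terminal.
  apply: rt1n_trans (_ : clos_refl_trans_1n _ _ (top (NT _ (idx Acc))) _).
    by apply: rewrites_root; left.
  by rewrite /top; apply: (@star_node _ _ datalog_grammar) => i; rewrite !ffunE.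
move=> A /In_flatten[s As /In_map[l es /In_mem]]; rewrite mem_iota => lm v.
have [c eA] : exists c, A = automaton c l.
  by move: As; rewrite -es => -[<-|[<-|//]]; [exists true | exists false].
subst A; rewrite sat_tree_vec ep; last first.
  by apply/forallP => i; rewrite ffunE; apply: fpure_pure.
rewrite /= (@nth_ord_image0 _ _ _ _ ord0) // ffunE.
by apply/eqP => e; apply: (represents_fine rp); exists c, l.
Qed.



End Instance.

(** * Facts about the run of a machine *)

Section Kinds.
Variable M : TM.
Notation K := (extra_tapes M).+1.
Notation C := (cell (extra M)).

Inductive kind :=
| KBlank | KAxiom | KAccept
| KInput of C
(* The boolean [true] marks facts about the time after [t]. *)
| KState of bool & state M & K.-tuple C
| KCell of bool & bool & 'I_K & C.

Definition kind_code (x : kind) :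
    'I_3 + C + bool * state M * K.-tuple C + bool * bool * 'I_K * C :=
  match x with
  | KBlank => inl (inl (inl (inord 0)))
  | KAxiom => inl (inl (inl (inord 1)))
  | KAccept => inl (inl (inl (inord 2)))
  | KInput x => inl (inl (inr x))
  | KState p q a => inl (inr (p, q, a))
  | KCell p b j x => inr (p, b, j, x)
  end.

Definition kind_decode (x : 'I_3 + C + bool * state M * K.-tuple C + bool * bool * 'I_K * C) : kind :=
  match x with
  | inl (inl (inl i)) => match val i with 0 => KBlank | 1 => KAxiom | _ => KAccept end
  | inl (inl (inr x)) => KInput x
  | inl (inr (p, q, a)) => KState p q a
  | inr (p, b, j, x) => KCell p b j x
  end.

Lemma kind_codeK : cancel kind_code kind_decode.
Proof. by case=> //=; rewrite inordK. Qed.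

HB.instance Definition _ := Finite.copy kind (can_type kind_codeK).

Definition side (b : bool) (t : tape (extra M)) := if b then right t else left t.

Definition dir (mv : move) : option bool :=
  match mv with MoveL => Some false | MoveN => None | MoveR => Some true end.

Lemma side_act b y mv t r :
  nth None (side b (act (y, mv) t)) r =
  match dir mv with
  | None => nth None (side b t) r
  | Some b' => if b' == b then nth None (side b t) r.+1
               else if r is r'.+1 then nth None (side b t) r' else y
  end.
Proof. by case: mv; case: b; case: r; case: t => l s u //= *; rewrite nth_behead. Qed.

Lemma scanned_act y mv (t : tape (extra M)) :
  scanned (act (y, mv) t) = if dir mv is Some b then nth None (side b t) 0 else y.
Proof. by case: mv => //=; rewrite nth0. Qed.

(** A head moving to side [b] brings the cells of that side nearer; the nearest one becomes scanned
    and drops out because [Rdec] has no result at 0. Moving away pushes the cells outwards and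
    leaves the written symbol at distance 0. The conclusions are marked [true] since a rule has one
    counter operation: here [r] may change, and a separate rule advances [t]. *)
Definition cell_rules (q : state M) (a : K.-tuple C) (acts : K.-tuple (C * move))
    (p : bool * 'I_K * C) : seq (rule kind) :=
  let: (b, j, x) := p in
  let S := BN (KState false q a) in
  let X := BMeet (BN (KCell false b j x)) S in
  match dir (tnth acts j).2 with
  | None => [:: (KCell true b j x, None, X)]
  | Some b' => if b' == b then [:: (KCell true b j x, Some Rdec, X)]
      else (KCell true b j x, Some Rinc, X) ::
           (if x == (tnth acts j).1 then [:: (KCell true b j x, None, S)] else [::])
  end.

(** A moving head will scan the nearest cell on the side it moves to, hence the [BTest]. The state
    fact is innermost on the left, so its counter value 0 is the one that is kept. *)
Definition scan_body (q : state M) (a : K.-tuple C) (acts : K.-tuple (C * move))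
    (a' : K.-tuple C) (s : seq 'I_K) : body kind :=
  foldr (fun j c => if dir (tnth acts j).2 is Some b
                    then BMeet c (BTest (BN (KCell false b j (tnth a' j)))) else c)
        (BN (KState false q a)) s.

(** A head that does not move scans what it has just written, which is known when the rules are
    generated; the other components of [a'] are checked by the body. *)
Definition scan_rules (q : state M) (a : K.-tuple C) (q' : state M)
    (acts : K.-tuple (C * move)) (a' : K.-tuple C) : seq (rule kind) :=
  if [forall j, ~~ dir (tnth acts j).2 ==> (tnth a' j == (tnth acts j).1)]
  then [:: (KState true q' a', None, scan_body q a acts a' (enum 'I_K))] else [::].

Definition step_rules (p : state M * K.-tuple C) : seq (rule kind) :=
  let: (q, a) := p in
  match delta q a with
  | None => if accept q then [:: (KAccept, None, BN (KState false q a))] else [::]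
  | Some (q', acts) =>
      flatten [seq cell_rules q a acts p | p : bool * 'I_K * C] ++
      flatten [seq scan_rules q a q' acts a' | a' : K.-tuple C]
  end.

Definition init_scan (x : C) : K.-tuple C := [tuple if i == ord0 then x else None | i < K].

Definition init_cell_rules (p : bool * 'I_K) : seq (rule kind) :=
  if p == (true, ord0) then [::] else [:: (KCell false p.1 p.2 None, None, BN KBlank)].

(** These rules depend on the machine alone, so up to bit positions their code is built into the
    printing program. Input position 0 is the scanned cell and position [r.+1] lies at distance [r],
    whence the [Rdec] and the [BTest] on [KInput]. *)
Definition machine_rules : seq (rule kind) :=
  [:: (KBlank, None, BZero); (KBlank, Some Rinc, BN KBlank)] ++
  [seq (KCell false p.1.1 p.1.2 p.2, Some Tinc, BN (KCell true p.1.1 p.1.2 p.2))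
     | p : bool * 'I_K * C] ++
  [seq (KState false p.1 p.2, Some Tinc, BN (KState true p.1 p.2))
     | p : state M * K.-tuple C] ++
  flatten [seq init_cell_rules p | p : bool * 'I_K] ++
  [seq (KCell false true ord0 x, Some Rdec, BN (KInput x)) | x : C] ++
  [seq (KState false (start_state M) (init_scan x), None, BTest (BN (KInput x))) | x : C] ++
  flatten [seq step_rules p | p : state M * K.-tuple C].

Lemma In_image (T : finType) U (f : T -> U) y : List.In y [seq f x | x : T] <-> exists x, f x = y.
Proof.
split=> [/In_map[x <- _]|[x <-]]; first by exists x.
by apply/In_map; exists x => //; apply/In_mem; rewrite mem_enum.
Qed.

Lemma In_flat_image (T : finType) U (f : T -> seq U) y :
  List.In y (flatten [seq f x | x : T]) <-> exists x, List.In y (f x).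
Proof.
split=> [/In_flatten[s ys /In_image[x e]]|[x h]]; first by exists x; rewrite e.
by apply/In_flatten; exists (f x) => //; apply/In_image; exists x.
Qed.

Lemma In_cat U (s1 s2 : seq U) y : List.In y (s1 ++ s2) <-> List.In y s1 \/ List.In y s2.
Proof. by split; [apply: (List.in_app_or s1 s2) | apply: (List.in_or_app s1 s2)]. Qed.

Lemma In_if U (c : bool) (s : seq U) y : List.In y (if c then s else [::]) <-> c /\ List.In y s.
Proof. by case: c; split=> // -[]. Qed.

Fixpoint bmap N N' (f : N -> N') (b : body N) : body N' :=
  match b with
  | BN x => BN (f x)
  | BZero => BZero
  | BMeet a b => BMeet (bmap f a) (bmap f b)
  | BTest a => BTest (bmap f a)
  end.

Definition rmap N N' (f : N -> N') (r : rule N) : rule N' :=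
  let: (x, o, b) := r in (f x, o, bmap f b).

(** * The Datalog program of one input, and its soundness *)

Section Input.
Variable w : word.
Notation n := (size w).

(** An index below [n] stands for that input position; the index [n] stands for all positions from
    [n] on, where the tape is blank. *)
Definition nonterminal : Type := (kind + 'I_n.+1)%type.

Definition letter_rules (i : nat) : seq (rule nonterminal) :=
  [:: (inl (KInput (bit_cell _ (nth false w i))), None, BN (inr (inord i)));
      (inr (inord i.+1), Some Rinc, BN (inr (inord i)))].

Definition end_rules : seq (rule nonterminal) :=
  [:: (inr (inord 0), None, BZero);
      (inl (KInput None), None, BN (inr (inord n)));
      (inr (inord n), Some Rinc, BN (inr (inord n)))].

Definition program : seq (rule nonterminal) :=
  map (rmap inl) machine_rules ++ flatten [seq letter_rules i | i <- iota 0 n] ++ end_rules.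

Definition conf t : config M := run t (init M w).

(** The intended meaning, preserved by every rule. For [KAxiom] and [KAccept] it ignores the
    counters and is the conclusion that soundness aims at. *)
Definition holds (x : nonterminal) (t r : nat) : Prop :=
  match x with
  | inl KBlank => t = 0
  | inl KAxiom | inl KAccept => exists t, halted (conf t) /\ accept (conf t).1
  | inl (KInput x) => t = 0 /\ nth None (map (@bit_cell (extra M)) w) r = x
  | inl (KState p q a) =>
      [/\ r = 0, (conf (t + p)).1 = q & map_tuple (@scanned _) (conf (t + p)).2 = a]
  | inl (KCell p b j x) => nth None (side b (tnth (conf (t + p)).2 j)) r = x
  | inr i => t = 0 /\ (if i < n then r = i else n <= r)
  end.

Fixpoint holds_body (b : body nonterminal) (t r : nat) : Prop :=
  match b with
  | BN x => holds x t r
  | BZero => t = 0 /\ r = 0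
  | BMeet a b => holds_body a t r /\ exists r', holds_body b t r'
  | BTest a => r = 0 /\ holds_body a t 0
  end.

Lemma confS t : conf t.+1 = odflt (conf t) (step (conf t)).
Proof. by []. Qed.

Lemma conf_step t q' acts :
  delta (conf t).1 (map_tuple (@scanned _) (conf t).2) = Some (q', acts) ->
  conf t.+1 = (q', [tuple act (tnth acts i) (tnth (conf t).2 i) | i < K]).
Proof. by rewrite confS /step => ->. Qed.

Lemma conf0_cell b j r : nth None (side b (tnth (conf 0).2 j)) r =
  if (b, j) == (true, ord0) then nth None (map (@bit_cell (extra M)) w) r.+1 else None.
Proof.
rewrite /conf /run /= tnth_mktuple xpair_eqE.
by case: b => /=; case: (j =P ord0) => //= _; rewrite ?nth_behead ?nth_nil.
Qed.

Lemma conf0_scan : map_tuple (@scanned _) (conf 0).2 = init_scan (nth None (map (@bit_cell (extra M)) w) 0).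
Proof.
apply: eq_from_tnth => i; rewrite tnth_map !tnth_mktuple.
by case: eqP => //= _; rewrite nth0.
Qed.

Lemma scan_body_holds q a acts a' s t r :
  holds_body (bmap inl (scan_body q a acts a' s)) t r <->
  holds (inl (KState false q a)) t r /\
  forall j b, j \in s -> dir (tnth acts j).2 = Some b -> holds (inl (KCell false b j (tnth a' j))) t 0.
Proof.
elim: s => [|j s IH]; first by split=> // -[].
rewrite /=; case e: (dir (tnth acts j).2) => [b|]; split.
- move=> [/IH[h1 h2] [r' [_ h3]]]; split=> // i b'; rewrite inE => /predU1P[->|]; last exact: h2.
  by rewrite e => -[<-].
- move=> [h1 h2]; split; first by apply/IH; split=> // i b' is_; apply: h2; rewrite inE is_ orbT.
  by exists 0; split=> //; apply: h2 => //; rewrite mem_head.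
- move=> /IH[h1 h2]; split=> // i b'; rewrite inE => /predU1P[->|]; last exact: h2.
  by rewrite e.
- by move=> [h1 h2]; apply/IH; split=> // i b' is_; apply: h2; rewrite inE is_ orbT.
Qed.

Lemma step_rules_sound p B o b m t r t' r' :
  List.In (B, o, b) (step_rules p) -> holds_body (bmap inl b) t r ->
  cop_rel m o t r t' r' -> holds (inl B) t' r'.
Proof.
case: p => q a /=; case ed: (delta q a) => [[q' acts]|]; last first.
  case/In_if=> acc [] // [<- <- <-] /= [_ e1 e2] _; exists t; rewrite addn0 in e1 e2.
  by rewrite /halted /step e1 e2 ed.
case/In_cat=> /In_flat_image[].
  move=> [[c j] x]; rewrite /cell_rules.
  (* The state fact determines the transition, and with it every cell after the step. *)
  have cellS t0 : holds (inl (KState false q a)) t0 0 ->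
     forall r0, nth None (side c (tnth (conf (t0 + true)).2 j)) r0 =
       match dir (tnth acts j).2 with
       | None => nth None (side c (tnth (conf t0).2 j)) r0
       | Some b' => if b' == c then nth None (side c (tnth (conf t0).2 j)) r0.+1
               else if r0 is r'.+1 then nth None (side c (tnth (conf t0).2 j)) r' else (tnth acts j).1
       end.
    move=> /= [_ e1 e2] r0; rewrite addn0 in e1 e2; rewrite addn1 (@conf_step _ q' acts) ?e1 ?e2 //.
    by rewrite tnth_mktuple -side_act; case: (tnth acts j).
  case ed': (dir (tnth acts j).2) cellS => [c'|] cellS.
    case: ifP cellS => cc cellS.
      case=> [] // [<- <- <-] /= [h1 [r0 h2]] [-> e]; rewrite addn0 in h1.
      (* [BMeet] has forgotten the counter [r0] of the state fact, but such a fact holds at 0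
         only. *)
      have h3 := h2; case: h2 => r00 _ _; rewrite r00 in h3.
      by rewrite (cellS _ h3) -e.
    case=> [[<- <- <-]|/In_if[/eqP ex [] // [<- <- <-]]] /=.
      move=> [h1 [r0 h2]] [-> -> _]; rewrite addn0 in h1.
      have h3 := h2; case: h2 => r00 _ _; rewrite r00 in h3.
      by rewrite (cellS _ h3).
    move=> h2 [-> ->].
    have h3 := h2; case: h2 => r00 _ _; rewrite r00 in h3 *.
    by rewrite (cellS _ h3).
  case=> [] // [<- <- <-] /= [h1 [r0 h2]] [-> ->]; rewrite addn0 in h1.
  have h3 := h2; case: h2 => r00 _ _; rewrite r00 in h3.
  by rewrite (cellS _ h3).
move=> a' /In_if[/forallP stay [] // [<- <- <-]] /scan_body_holds[h1 h2] [-> ->].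
case: h1 => r0 e1 e2; rewrite addn0 in e1 e2.
rewrite /= addn1 (@conf_step _ q' acts) ?e1 ?e2 //; split=> //.
apply: eq_from_tnth => j; rewrite tnth_map tnth_mktuple.
have := stay j; have := h2 j; rewrite mem_enum.
case: (tnth acts j) => y mv /=; rewrite scanned_act addn0.
by case: (dir mv) => [c /(_ c isT erefl)|_ /eqP->].
Qed.

Lemma machine_rules_sound B o b m t r t' r' :
  List.In (B, o, b) machine_rules -> holds_body (bmap inl b) t r ->
  cop_rel m o t r t' r' -> holds (inl B) t' r'.
Proof.
case/In_cat=> [[[<- <- <-]|[[<- <- <-]|//]]|] /=.
- by move=> [-> _] [-> _].
- by move=> -> [-> _].
case/In_cat=> [/In_image[[[c j] x] /= [<- <- <-]] /= h [-> -> _]|].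
  by rewrite addn1 in h; rewrite addn0.
case/In_cat=> [/In_image[[q a] /= [<- <- <-]] /= h [-> -> _]|].
  by rewrite addn1 in h; rewrite addn0.
case/In_cat=> [/In_flat_image[[c j]]|].
  rewrite /init_cell_rules; case: ifP => // ne [] // [<- <- <-] /= -> [-> ->].
  by rewrite addn0 conf0_cell ne.
case/In_cat=> [/In_image[x [<- <- <-]] /= [-> h] [-> e]|].
  by rewrite addn0 (conf0_cell true) eqxx -e.
case/In_cat=> [/In_image[x [<- <- <-]] /= [-> [-> h]] [-> ->]|].
  by rewrite addn0 conf0_scan h.
case/In_flat_image=> p; exact: step_rules_sound.
Qed.

Lemma letter_rules_sound i B o b m t r t' r' : i < n ->
  List.In (B, o, b) (letter_rules i) -> holds_body b t r ->
  cop_rel m o t r t' r' -> holds B t' r'.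
Proof.
move=> lt [[<- <- <-]|[[<- <- <-]|//]] /=; rewrite inordK ?ltnS ?(ltnW lt) // lt.
  by move=> [-> ->] [-> ->]; split=> //; rewrite (nth_map false).
move=> [-> ->] [-> -> _]; rewrite inordK //; split=> //.
by case: ltnP => // le; apply/eqP; rewrite eqn_leq lt.
Qed.

Lemma end_rules_sound B o b m t r t' r' :
  List.In (B, o, b) end_rules -> holds_body b t r ->
  cop_rel m o t r t' r' -> holds B t' r'.
Proof.
case=> [[<- <- <-]|[[<- <- <-]|[[<- <- <-]|//]]] /=; rewrite inordK ?ltnn //.
- by move=> [-> ->] [-> ->]; split=> //; case: ltnP.
- by move=> [-> le] [-> ->]; split=> //; rewrite nth_default // size_map.
- by move=> [-> le] [-> -> _]; split=> //; apply: leqW.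
Qed.

Lemma program_sound m t r :
  prov m (with_axiom program (inl KAxiom) (inl KAccept)) (BN (inl KAxiom)) t r ->
  exists t, halted (conf t) /\ accept (conf t).1.
Proof.
suff sound b t0 r0 : prov m (with_axiom program (inl KAxiom) (inl KAccept)) b t0 r0 -> holds_body b t0 r0.
  by move/sound.
elim=> {b t0 r0} [B o b t0 r0 t' r' rP _ IH c||a b t0 r0 r' _ IHa _ IHb|a t0 _ IH] //=.
  case: rP => [[e1 e2 e3]|].
    by move: IH c; rewrite -e1 -e2 -e3.
  move=> rP; have {}rP : List.In (B, o, b) program := rP.
  case/In_cat: rP IH c => [/In_map[[[B' o'] b'] [<- <- <-] rP]|].
    exact: machine_rules_sound rP.
  case/In_cat=> [/In_flatten[s sP /In_map[i es /In_mem]]|rP].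
    by rewrite mem_iota => lt; rewrite -es in sP; apply: letter_rules_sound sP.
  exact: end_rules_sound rP.
by split=> //; exists r'.
Qed.

(** * Derivability of the facts about the run *)

Section Complete.
Variable m : nat.
Notation derivable := (prov m program).

Lemma In_machine r : List.In r machine_rules -> List.In (rmap inl r) program.
Proof. by move=> h; apply/In_cat; left; apply/In_map; exists r. Qed.

Lemma derive_machine B o b t r t' r' : List.In (B, o, b) machine_rules ->
  derivable (bmap inl b) t r -> cop_rel m o t r t' r' -> derivable (BN (inl B)) t' r'.
Proof. by move=> /In_machine /= h; apply: prov_rule. Qed.

Lemma derive_blank r : r < 2 ^ m -> derivable (BN (inl KBlank)) 0 r.
Proof.
elim: r => [|r IH] lt.
  by apply: (@derive_machine _ None BZero 0 0); [left | apply: prov_zero |].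
apply: (@derive_machine _ (Some Rinc) (BN KBlank) 0 r) => //; first by right; left.
exact: IH (ltnW lt).
Qed.

Lemma In_letter i x : i < n -> List.In x (letter_rules i) -> List.In x program.
Proof.
move=> lt h; apply/In_cat; right; apply/In_cat; left; apply/In_flatten.
exists (letter_rules i) => //; apply/In_map; exists i => //.
by apply/In_mem; rewrite mem_iota.
Qed.

Lemma In_end x : List.In x end_rules -> List.In x program.
Proof. by move=> h; apply/In_cat; right; apply/In_cat; right. Qed.

Lemma derive_index r : r < 2 ^ m -> derivable (BN (inr (inord (minn r n)))) 0 r.
Proof.
elim: r => [|r IH] lt.
  rewrite min0n; apply: (@prov_rule _ _ _ _ None BZero 0 0) => //; last exact: prov_zero.
  by apply: In_end; left.
have [rn|nr] := ltnP r n.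
  rewrite (minn_idPl rn); apply: (@prov_rule _ _ _ _ (Some Rinc) _ 0 r _ _ _ (IH (ltnW lt))) => //.
  by rewrite (minn_idPl (ltnW rn)); apply: In_letter rn _; right; left.
rewrite (minn_idPr (leqW nr)).
apply: (@prov_rule _ _ _ _ (Some Rinc) _ 0 r _ _ _ (IH (ltnW lt))) => //.
by rewrite (minn_idPr nr); apply: In_end; right; right; left.
Qed.

Lemma derive_input r : r < 2 ^ m ->
  derivable (BN (inl (KInput (nth None (map (@bit_cell (extra M)) w) r)))) 0 r.
Proof.
move=> lt; have [rn|nr] := ltnP r n.
  apply: (@prov_rule _ _ _ _ None _ 0 r _ _ _ (derive_index lt)) => //.
  by rewrite (minn_idPl (ltnW rn)) (nth_map false) //; apply: In_letter rn _; left.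
apply: (@prov_rule _ _ _ _ None _ 0 r _ _ _ (derive_index lt)) => //.
rewrite (minn_idPr nr) nth_default ?size_map //.
by apply: In_end; right; left.
Qed.

Lemma In_machine_cell c j x :
  List.In (KCell false c j x, Some Tinc, BN (KCell true c j x)) machine_rules.
Proof. by apply/In_cat; right; apply/In_cat; left; apply/In_image; exists (c, j, x). Qed.

Lemma In_machine_state q a :
  List.In (KState false q a, Some Tinc, BN (KState true q a)) machine_rules.
Proof.
apply/In_cat; right; apply/In_cat; right; apply/In_cat; left.
by apply/In_image; exists (q, a).
Qed.

Lemma In_machine_init p x : List.In x (init_cell_rules p) -> List.In x machine_rules.
Proof.
move=> h; do 3 (apply/In_cat; right); apply/In_cat; left.
by apply/In_flat_image; exists p.
Qed.

Lemma In_machine_input x :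
  List.In (KCell false true ord0 x, Some Rdec, BN (KInput x)) machine_rules.
Proof. by do 4 (apply/In_cat; right); apply/In_cat; left; apply/In_image; exists x. Qed.

Lemma In_machine_start x :
  List.In (KState false (start_state M) (init_scan x), None, BTest (BN (KInput x))) machine_rules.
Proof. by do 5 (apply/In_cat; right); apply/In_cat; left; apply/In_image; exists x. Qed.

Lemma In_machine_step p x : List.In x (step_rules p) -> List.In x machine_rules.
Proof. by move=> h; do 6 (apply/In_cat; right); apply/In_flat_image; exists p. Qed.

Definition scan (t : nat) := map_tuple (@scanned (extra M)) (conf t).2.

Lemma derive_scan_body q a acts a' s t r :
  derivable (BN (inl (KState false q a))) t r ->
  (forall j b, j \in s -> dir (tnth acts j).2 = Some b ->
     derivable (BN (inl (KCell false b j (tnth a' j)))) t 0) ->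
  derivable (bmap inl (scan_body q a acts a' s)) t r.
Proof.
move=> h; elim: s => [|j s IH] //= hs.
have {}IH := IH (fun i b is_ => hs i b (mem_behead (s := j :: s) is_)).
case e: (dir _) => [b|] //; apply: prov_meet IH _.
by apply: prov_test; apply: hs => //; rewrite mem_head.
Qed.

(** A cell at distance [r] was at distance at most [r.+1] one step earlier, so [t + r] bounds the
    distances met on the way back to time 0. One more is needed there, since distance [r] to the
    right is input position [r.+1]. *)
Lemma derive_conf t : (forall t', t' < t -> ~~ halted (conf t')) -> t.+1 < 2 ^ m ->
  derivable (BN (inl (KState false (conf t).1 (scan t)))) t 0 /\
  forall b j r, t + r + 1 < 2 ^ m ->
    derivable (BN (inl (KCell false b j (nth None (side b (tnth (conf t).2 j)) r)))) t r.
Proof.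
elim: t => [|t IH] nh lt.
  split.
    rewrite /scan conf0_scan; apply: derive_machine (In_machine_start _) _ _ => //=.
    by apply: prov_test; apply: derive_input; rewrite expn_gt0.
  move=> b j r; rewrite add0n addn1 => lt'.
  rewrite conf0_cell; case: ifP => [/eqP[-> ->]|ne].
    by apply: derive_machine (In_machine_input _) (derive_input lt') _.
  apply: (@derive_machine _ None (BN KBlank) 0 r) => //; last exact: derive_blank (ltnW lt').
  by apply: (@In_machine_init (b, j)); rewrite /init_cell_rules ne; left.
have [IHs IHc] := IH (fun t' lt' => nh t' (ltnW lt')) (ltnW lt).
have := nh t (ltnSn t); rewrite /halted /step -/(scan t).
case ed: (delta (conf t).1 (scan t)) => [[q' acts]|] // _.
have ec := @conf_step t q' acts ed.
have step_in x : List.In x (step_rules ((conf t).1, scan t)) -> List.In x machine_rules.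
  exact: In_machine_step.
rewrite /step_rules ed in step_in.
have cellE b j r : nth None (side b (tnth (conf t.+1).2 j)) r =
   match dir (tnth acts j).2 with
  | None => nth None (side b (tnth (conf t).2 j)) r
  | Some b' => if b' == b then nth None (side b (tnth (conf t).2 j)) r.+1
               else if r is r'.+1 then nth None (side b (tnth (conf t).2 j)) r' else (tnth acts j).1
  end.
  by rewrite ec tnth_mktuple -side_act; case: (tnth acts j).
have meetS X r : derivable X t r ->
   derivable (BMeet X (BN (inl (KState false (conf t).1 (scan t))))) t r.
  by move=> h; apply: prov_meet IHs.
split.
  apply: (derive_machine (@In_machine_state _ _) (t := t) (r := 0)); last by split=> //; lia.
  apply: (@derive_machine _ None (scan_body (conf t).1 (scan t) acts (scan t.+1) (enum 'I_K)) t 0) => //.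
    apply: step_in; apply/In_cat; right; apply/In_flat_image; exists (scan t.+1).
    rewrite /scan_rules ifT; first by left; rewrite ec.
    apply/forallP => j; apply/implyP; rewrite /scan tnth_map ec tnth_mktuple.
    by case: (tnth acts j) => y mv /=; rewrite scanned_act; case: dir.
  apply: derive_scan_body => // j b _ ej.
  rewrite /scan tnth_map ec tnth_mktuple.
  have -> : scanned (act (tnth acts j) (tnth (conf t).2 j)) = nth None (side b (tnth (conf t).2 j)) 0.
    by move: ej; case: (tnth acts j) => y mv /= ej; rewrite scanned_act ej.
  by apply: IHc; lia.
move=> b j r ltr; set x := nth _ _ _.
apply: (derive_machine (@In_machine_cell _ _ _) (t := t) (r := r)); last by split=> //; lia.
have cell_in y : List.In y (cell_rules (conf t).1 (scan t) acts (b, j, x)) -> List.In y machine_rules.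
  by move=> h; apply: step_in; apply/In_cat; left; apply/In_flat_image; exists (b, j, x).
have xE := cellE b j r; rewrite -/x in xE.
rewrite /cell_rules in cell_in.
case ed': (dir (tnth acts j).2) xE cell_in => [b'|] xE cell_in; last first.
  apply: (derive_machine (cell_in _ (or_introl erefl)) (t := t) (r := r)) => //=.
  by apply: meetS; rewrite xE; apply: IHc; lia.
case: ifP xE cell_in => bb xE cell_in.
  apply: (derive_machine (cell_in _ (or_introl erefl)) (t := t) (r := r.+1)) => //=.
  by apply: meetS; rewrite xE; apply: IHc; lia.
(* The head moves away from this side: distance 0 holds the symbol just written, and larger
   distances come from the old cell one nearer. *)
case: r ltr @x xE cell_in => [|r] ltr x xE cell_in.
  apply: (@derive_machine _ None (BN (KState false (conf t).1 (scan t))) t 0) => //.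
  by apply: cell_in; right; rewrite xE eqxx; left.
apply: (derive_machine (cell_in _ (or_introl erefl)) (t := t) (r := r)) => //=.
  by apply: meetS; rewrite xE; apply: IHc; lia.
by split=> //; lia.
Qed.

Lemma program_complete T : T.+1 < 2 ^ m -> halted (conf T) -> accept (conf T).1 ->
  exists t r, derivable (BN (inl KAccept)) t r.
Proof.
move=> lt hT aT.
have ex : exists t, halted (conf t) by exists T.
(* Before the first halting time every configuration has a transition, as [derive_conf] requires. *)
case: (ex_minnP ex) => t ht min_t.
have tT : t <= T := min_t _ hT.
have eT : conf T = conf t by rewrite -(subnK tT) /conf run_add run_halted.
have nh t' : t' < t -> ~~ halted (conf t').
  by move=> lt'; apply/negP => /min_t; rewrite leqNgt lt'.
have [hs _] := derive_conf nh (@leq_ltn_trans T.+1 t.+1 _ tT lt).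
exists t, 0; apply: (@derive_machine _ None (BN (KState false (conf t).1 (scan t))) t 0) => //.
apply: (@In_machine_step ((conf t).1, scan t)); rewrite /step_rules.
move: ht; rewrite /halted /step -/(scan t); case: (delta _ _) => [[]|] // _.
by rewrite -eT aT; left.
Qed.
End Complete.

End Input.
End Kinds.

(** * The code of the instance *)

Lemma map_ord T N (H : nat -> T) : [seq H i | i : 'I_N] = [seq H i | i <- iota 0 N].
Proof. by rewrite -val_enum_ord -map_comp. Qed.

Lemma flatten_iota3 (T : Type) (H : nat -> seq T) N :
  flatten [seq H f | f <- iota 0 (N * 3)] =
  flatten [seq H (l * 3) ++ H (l * 3 + 1) ++ H (l * 3 + 2) | l <- iota 0 N].
Proof.
elim: N => // N IH; rewrite -[N.+1]addn1 mulnDl iotaD map_cat flatten_cat IH iotaD.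
by rewrite map_cat flatten_cat /= !add0n !cats0 addn1 addn2.
Qed.

Lemma flatten_nseq3 (T : Type) (u : seq T) p :
  flatten (nseq (p * 3) u) = flatten (nseq p (flatten (nseq 3 u))).
Proof. by elim: p => // p IH; rewrite mulSn nseqD flatten_cat IH. Qed.

Lemma flatten_pairs (T : Type) (g : T -> word) (F G : nat -> T) s :
  flatten [seq true :: g x | x <- flatten [seq [:: F l; G l] | l <- s]] =
  flatten [seq (true :: g (F l)) ++ (true :: g (G l)) | l <- s].
Proof. by elim: s => //= l s ->; rewrite -catA. Qed.

Lemma code_seq_cons (T : Type) (e : T -> word) x s :
  code_seq e (x :: s) = true :: e x ++ code_seq e s.
Proof. by rewrite /code_seq /= -catA. Qed.

Lemma flatten_split (T : Type) (H : bool -> bool -> seq T) N l : l < N ->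
  flatten [seq H (j < l) (l < j) | j <- iota 0 N] =
  flatten (nseq l (H true false)) ++ H false false ++ flatten (nseq (N - l.+1) (H false true)).
Proof.
move=> lN; pose p := N - l.+1; rewrite -/p.
have -> : N = l + (1 + p) by rewrite addnA addn1 subnKC.
have const q b (x y : bool) : (forall j, b <= j < b + q -> (j < l) = x /\ (l < j) = y) ->
    flatten [seq H (j < l) (l < j) | j <- iota b q] = flatten (nseq q (H x y)).
  move=> h; elim: q b h => //= q IH b h.
  have [-> ->] := h b ltac:(by rewrite leqnn addnS ltnS leq_addr).
  congr (_ ++ _); apply: IH => j /andP[bj jq].
  by apply: h; rewrite (ltnW bj) addnS -addSn.
rewrite !iotaD !map_cat !flatten_cat; congr (_ ++ (_ ++ _)).
- by apply: const => j; rewrite add0n => /andP[_ jl]; rewrite jl ltnNge (ltnW jl).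
- by rewrite /= add0n !ltnn cats0.
- by apply: const => j /andP[lj _]; rewrite add0n addn1 in lj; rewrite lj ltnNge (ltnW lj).
Qed.

Lemma code_nat_add a b : code_nat (a + b) = nseq a true ++ flatten (nseq b [:: true]) ++ [:: false].
Proof. by rewrite /code_nat nseqD -catA; congr (_ ++ (_ ++ _)); elim: b => //= b <-. Qed.

Section Code.
Variables (k m : nat) (N : Type) (nN : nat) (idx : N -> 'I_nN) (B0 : 'I_nN).
Variables (P : seq (rule N)) (Ax Acc : N).

Definition table (ar : nat) (g : seq 'I_3 -> 'I_3) : word :=
  code_seq (fun a : 'I_3 => code_nat a) [seq g (val u) | u <- enum {: ar.-tuple 'I_3}].

(** The relation symbols are the same for every [m], so [tau 0] may be used and the word is a
    constant. *)
Definition rel_table : word :=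
  code_nat 2 ++ flatten [seq code_seq code_bool (codom [ffun u : (rar r).-tuple 'I_3 => nth err u 0 != err])
    | r : rsym (tau 0)].

Definition cop_table (c : bool) (below above : bool) : word :=
  table 1 (fun s => count_op c 0 below above (nth err s 0)) ++
  table 1 (fun s => count_op c 1 below above (nth err s 0)) ++
  table 1 (fun s => count_op c 2 below above (nth err s 0)).

(** Zero, meet and test do not depend on the bit position; 0 is an arbitrary choice. *)
Definition base_tables (c : bool) : word :=
  table 0 (interp c 0 0) ++ table 2 (interp c 0 1) ++ table 1 (interp c 0 2).

(** The counter tables see only whether their position is below, at or above [l]. The code is thus
    made of constant blocks repeated [l] times, once and [m - l.+1] times, which [before] and
    [after] can print from the head position [l]. *)
Lemma code_automaton c l : l < m -> code_structure (automaton m c l) =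
  rel_table ++ base_tables c ++ flatten (nseq l (cop_table c true false)) ++
  cop_table c false false ++ flatten (nseq (m - l.+1) (cop_table c false true)).
Proof.
move=> lm; rewrite /code_structure catA; congr (_ ++ _).
rewrite -(flatten_split _ lm).
have -> : [seq code_seq (fun a : dom (automaton m c l) => code_nat a) (codom (fun_int (automaton m c l) f)) | f : Defs.fsym (tau m)]
  = [seq table (farity m f) (interp c l f) | f : 'I_(size (fun_ars (tau m)))].
  apply: eq_map => f; congr code_seq; rewrite /codom /image_mem.
  by apply: eq_map => u; rewrite ffunE.
rewrite (map_ord _ (fun f => table (farity m f) (interp c l f))).
have -> : size (fun_ars (tau m)) = 3 + m * 3 by rewrite -[in RHS](size_nseq (m * 3) 1).
rewrite iotaD map_cat flatten_cat; congr (_ ++ _); first by rewrite /base_tables /= cats0.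
rewrite -[0 + 3]/(3 + 0) iotaDl -map_comp.
have -> : [seq ((fun f => table (farity m f) (interp c l f)) \o addn 3) i | i <- iota 0 (m * 3)] =
  [seq table 1 (fun s => count_op c (i %% 3) (i %/ 3 < l) (l < i %/ 3) (nth err s 0)) | i <- iota 0 (m * 3)].
  by apply/eq_in_map => i; rewrite mem_iota => im; rewrite /= farity_cop.
rewrite (flatten_iota3 (fun i => table 1 (fun s => count_op c (i %% 3) (i %/ 3 < l) (l < i %/ 3) (nth err s 0)))).
congr flatten; apply: eq_map => i.
by rewrite /cop_table mulnK // modnMl !divnMDl // !modnMDl !addn0.
Qed.

Fixpoint code_body (b : body N) : word :=
  match b with
  | BN x => code_nat 0 ++ code_nat (idx x)
  | BZero => code_nat 2 ++ code_nat 0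
  | BMeet a b => (code_nat 2 ++ code_nat 1) ++ code_body a ++ code_body b
  | BTest a => (code_nat 2 ++ code_nat 2) ++ code_body a
  end.

(** The number of [fcop i l] in unary, split so that only the block of three marks per position
    depends on [l]. *)
Definition code_cop (o : option cop) (l : nat) : word :=
  if o is Some i then
    code_nat 2 ++ nseq (copn i).+3 true ++ flatten (nseq l [:: true; true; true]) ++ [:: false]
  else [::].

Definition code_rule (l : nat) (r : rule N) : word :=
  let: (x, o, b) := r in true :: code_nat (idx x) ++ code_cop o l ++ code_body b.

Lemma code_app f s : f < m * 3 + 3 -> farity m f = size s ->
  code_tree (@app k m nN B0 f s) = (code_nat 2 ++ code_nat f) ++ flatten [seq code_tree x | x <- s].
Proof.
move=> lt ar; rewrite -[LHS]/((code_nat 2 ++ code_nat (fsymb m f)) ++ _) (fsymbE lt).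
congr (_ ++ flatten _).
have ar' : far (fsymb m f) = size s by rewrite far_fsymb.
apply: (@eq_from_nth _ [::]) => [|i]; rewrite size_image card_ord; first by rewrite size_map; apply: ar'.
move=> lti; rewrite (nth_map (Ordinal lti)) ?size_enum_ord // (nth_ord_enum _ (Ordinal lti)) ffunE.
by rewrite (nth_map (NT _ B0)) // -ar'.
Qed.

Lemma code_btree b : code_tree (btree k m idx B0 b) = code_body b.
Proof.
elim: b => [//||a IHa b IHb|a IHa].
- by rewrite -[LHS]/(code_tree (app B0 0 [::])) code_app ?addn3 //= cats0.
- rewrite -[LHS]/(code_tree (app B0 1 [:: btree k m idx B0 a; btree k m idx B0 b])).
  by rewrite code_app ?addn3 //; rewrite /= cats0 IHa IHb.
- rewrite -[LHS]/(code_tree (app B0 2 [:: btree k m idx B0 a])).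
  by rewrite code_app ?addn3 //; rewrite /= cats0 IHa.
Qed.

Lemma code_rtree l r : l < m ->
  true :: code_nat (rtree k m idx B0 l r).1 ++ code_tree (rtree k m idx B0 l r).2 = code_rule l r.
Proof.
case: r => [[x [i|]] b] lm; rewrite /code_rule /rtree; congr (_ :: (_ ++ _)); last exact: code_btree.
rewrite -[LHS]/(code_tree (app B0 (fcop i l) [:: btree k m idx B0 b])).
rewrite (@code_app _ [:: _] (fcop_lt i lm) (farity_fcop i lm)).
rewrite -code_btree.
rewrite (_ : flatten _ = code_tree (btree k m idx B0 b)); last by rewrite /= cats0.
congr (_ ++ _); congr (_ ++ _).
rewrite /fcop -addnS -addnS -addnS addnC code_nat_add; congr (_ ++ (_ ++ _)).
by elim: l {lm} => //= l <-.
Qed.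

Lemma code_datalog_instance : code_instance (datalog_instance k m idx P Ax Acc B0) =
  (code_seq code_nat [:: 1] ++ (true :: code_nat 0) ++ (true :: code_nat 2) ++ (true :: code_nat 1)) ++
  flatten (nseq m (flatten (nseq 3 (true :: code_nat 1)))) ++ [:: false] ++
  flatten [seq (true :: code_structure (automaton m true l)) ++ (true :: code_structure (automaton m false l))
    | l <- iota 0 m] ++ [:: false; false] ++
  code_nat nN ++ (code_nat (idx Ax) ++ true :: code_nat (idx Ax) ++
    code_nat 1 ++ code_nat 0 ++ code_nat 0 ++ code_nat (idx Acc)) ++
  flatten [seq flatten [seq code_rule l r | r <- P] | l <- iota 0 m] ++ [:: false].
Proof.
rewrite /code_instance /code_signature.
have -> : code_seq code_nat (fun_ars (sig (datalog_instance k m idx P Ax Acc B0))) =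
   (true :: code_nat 0) ++ (true :: code_nat 2) ++ (true :: code_nat 1) ++
   flatten (nseq m (flatten (nseq 3 (true :: code_nat 1)))) ++ [:: false].
  rewrite /code_seq -[fun_ars _]/([:: 0; 2; 1] ++ nseq (m * 3) 1) map_cat flatten_cat map_nseq.
  by rewrite flatten_nseq3 -catA.
have -> : code_seq (@code_structure (tau m)) (Pos (datalog_instance k m idx P Ax Acc B0)) =
  flatten [seq (true :: code_structure (automaton m true l)) ++ (true :: code_structure (automaton m false l))
    | l <- iota 0 m] ++ [:: false].
  rewrite /code_seq; congr (_ ++ _).
  exact: flatten_pairs.
have -> : code_grammar (gram (datalog_instance k m idx P Ax Acc B0)) =
  code_nat nN ++ (code_nat (idx Ax) ++ true :: code_nat (idx Ax) ++
    code_nat 1 ++ code_nat 0 ++ code_nat 0 ++ code_nat (idx Acc)) ++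
  flatten [seq flatten [seq code_rule l r | r <- P] | l <- iota 0 m] ++ [:: false].
  rewrite /code_grammar -[rules _]/((_, @top k m nN (NT _ _)) :: _) code_seq_cons.
  have -> : code_tree (@top k m nN (NT (@fo_rank k (tau m)) (idx Acc))) =
     code_nat 1 ++ code_nat 0 ++ code_nat 0 ++ code_nat (idx Acc).
    rewrite -[LHS]/((code_nat 1 ++ code_nat 0) ++ _) -catA; congr (_ ++ (_ ++ _)).
    by rewrite /image_mem enum_ordSl enum_ord0 /= ffunE cats0.
  have -> : forall g : _ -> word, (forall r l, l < m -> true :: g (rtree k m idx B0 l r) = code_rule l r) ->
      code_seq g (flatten [seq [seq rtree k m idx B0 l r | r <- P] | l <- iota 0 m]) =
      flatten [seq flatten [seq code_rule l r | r <- P] | l <- iota 0 m] ++ [:: false].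
  - move=> g gE; congr (_ ++ _).
    have : all (fun l => l < m) (iota 0 m) by apply/allP => l; rewrite mem_iota.
    elim: (iota 0 m) => //= l s IH /andP[lm /IH e].
    rewrite map_cat flatten_cat e -map_comp; congr (flatten _ ++ _).
    by apply: eq_map => r; apply: gE.
  - have assoc (a b t R : word) : b ++ a ++ true :: (a ++ t) ++ R = b ++ (a ++ true :: a ++ t) ++ R.
      by rewrite -!catA /= -!catA.
    exact: assoc.
  - by move=> r l; apply: code_rtree.
by rewrite -!catA.
Qed.
End Code.

Lemma flatten_map_flatten (I T U : Type) (f : T -> seq U) (g : I -> seq T) s :
  flatten [seq f x | x <- flatten [seq g i | i <- s]] =
  flatten [seq flatten [seq f x | x <- g i] | i <- s].
Proof. by elim: s => //= i s IH; rewrite map_cat flatten_cat IH. Qed.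

(** * The reduction, its correctness and its running time *)

Section Reduction.
Variables (k : nat) (M : TM) (c d : nat).
Notation size_m := (mw c.*2.+1 d).
Notation kappa := #|{: kind M}|.

(** Kinds are numbered before input positions, so that their codes do not depend on [w] and a
    position is coded as a constant prefix followed by its unary numeral. *)
Definition index (w : word) (x : nonterminal M w) : 'I_(kappa + (size w).+1) :=
  match x with
  | inl a => lshift (size w).+1 (enum_rank a)
  | inr i => rshift kappa i
  end.

Lemma index_inj w : injective (@index w).
Proof.
move=> [a|i] [b|j] /(f_equal val) /=.
- by move=> /val_inj/enum_rank_inj->.
- by move=> e; have := ltn_ord (enum_rank a); rewrite e ltnNge leq_addr.
- by move=> e; have := ltn_ord (enum_rank b); rewrite -e ltnNge leq_addr.
- by move=> /addnI/val_inj->.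
Qed.

Definition reduction (w : word) : instance k :=
  datalog_instance k (size_m w) (@index w) (program M w) (inl (KAxiom M)) (inl (KAccept M))
    (@index w (inl (KAxiom M))).

(** Two bits beyond the exponent of the time bound [T] give [2 ^ m >= 4 * T], which exceeds [T.+1].
    The factor [c.*2.+2] pays for both occurrences of [c] and for the 2. *)
Lemma msize_large n : c * n ^ d + c + 2 <= msize c.*2.+1 d n.
Proof.
rewrite /msize expnS; have : n ^ d <= n.+1 ^ d by apply: leq_exp2r_le.
have : 0 < n.+1 ^ d by rewrite expn_gt0.
move: (n ^ d) (n.+1 ^ d) => x y y0 xy.
apply: (@leq_trans (c.*2.+2 * y)); first by nia.
by rewrite leq_mul2l; apply/orP; right; apply: leq_pmull.
Qed.

Lemma reduction_correct (L : language) :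
  decides_in_time M (fun n => 2 ^ (c * n ^ d + c)) L ->
  forall w, L w <-> realizable (reduction w).
Proof.
move=> dec w; have [] := dec w; set T := 2 ^ _ => hT aT.
have large := msize_large (size w); rewrite -/(size_m w) in large.
have m0 : 0 < size_m w by lia.
have lt : T.+1 < 2 ^ size_m w.
  apply: (@leq_trans (2 ^ (c * size w ^ d + c + 2))); last by rewrite leq_exp2l.
  have : 0 < T by rewrite expn_gt0.
  by rewrite expnD -/T; lia.
rewrite -aT; split.
  move=> acc; have [t [r pr]] := @program_complete M w (size_m w) T lt hT acc.
  exact: (@datalog_instance_complete k _ _ _ (@index w) (program M w) _ _ _ m0 t r pr).
move/(datalog_instance_sound (@index_inj w)) => [t [r /program_sound [t' [ht at_]]]].
have -> // : run T (init M w) = conf M w t'.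
(* Halted configurations are kept, so two halting times give the same configuration, whichever comes
   first. *)
have [le|le] := leqP t' T; first by rewrite -(subnK le) run_add run_halted.
by rewrite /conf -(subnK (ltnW le)) run_add (run_halted _ hT).
Qed.

Notation emits_for := (emittable c.*2.+1 d).

Definition kind_body : body (kind M) -> word :=
  @code_body _ kappa (fun x => enum_rank x).

Lemma code_body_kind w b : code_body (@index w) (bmap inl b) = kind_body b.
Proof. by elim: b => //= [a -> b ->|a ->]. Qed.

Lemma emit_all (T : Type) bi bl (e : T -> word -> nat -> nat -> word) (s : seq T) :
  (forall x, emits_for bi bl (e x)) ->
  emits_for bi bl (fun w i l => flatten [seq e x w i l | x <- s]).
Proof.
move=> h; elim: s => [|x s IH]; first exact: emit_const.
exact: emit_cat (h x) IH.
Qed.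

Lemma emit_full_X bi u : emits_for bi false (fun w _ _ => flatten (nseq (size_m w) u)).
Proof. by apply: emit_ext (emit_before_X _ _ bi false u) _ => w i l _ /eqP->. Qed.

Lemma emit_cop bi bl o : emits_for bi bl (fun _ _ l => code_cop o l).
Proof.
case: o => [i|]; last exact: emit_const.
do 2 (apply: emit_cat; first exact: emit_const).
by apply: emit_cat; [exact: emit_before_X | exact: emit_const].
Qed.

Definition index_word (i : nat) : word := nseq kappa true ++ flatten (nseq i [:: true]) ++ [:: false].

Lemma index_wordE w (i : nat) : i <= size w -> code_nat (@index w (inr (inord i))) = index_word i.
Proof. by move=> le; rewrite /= inordK // code_nat_add. Qed.

Lemma emit_index bi bl : emits_for bi bl (fun _ i _ => index_word i).
Proof.
apply: emit_cat; first exact: emit_const.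
by apply: emit_cat; [exact: emit_before_in | exact: emit_const].
Qed.

Lemma emit_index_succ bi bl : emits_for bi bl (fun _ i _ => index_word i.+1).
Proof.
apply: emit_cat; first exact: emit_const.
apply: emit_cat; last exact: emit_const.
apply: (@emit_cat _ _ _ _ (fun _ _ _ => [:: true]) (fun _ i _ => flatten (nseq i [:: true]))).
  exact: emit_const.
exact: emit_before_in.
Qed.

Definition machine_rule_word (r : rule (kind M)) (l : nat) : word :=
  let: (x, o, b) := r in true :: code_nat (enum_rank x) ++ code_cop o l ++ kind_body b.

Definition index_body (i : nat) : word := code_nat 0 ++ index_word i.

Lemma emit_index_body bi bl : emits_for bi bl (fun _ i _ => index_body i).
Proof. by apply: emit_cat; [exact: emit_const | exact: emit_index]. Qed.

Lemma emit_machine_rule bi bl r : emits_for bi bl (fun _ _ l => machine_rule_word r l).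
Proof.
case: r => [[x o] b]; apply: (@emit_cat _ _ _ _ (fun _ _ _ => true :: code_nat (enum_rank x))).
  exact: emit_const.
by apply: emit_cat; [exact: emit_cop | exact: emit_const].
Qed.

(** The only place where the value of an input bit matters: the scanned letter selects the [KInput]
    nonterminal. *)
Lemma emit_letter_rules bl : emits_for true bl
  (fun w i l => flatten [seq code_rule (@index w) l r | r <- letter_rules M w i]).
Proof.
pose inp x : word := true :: code_nat (enum_rank (KInput x : kind M)).
apply: (@emit_ext _ _ _ _ (fun w i l =>
  (if nth false w i then inp (bit_cell _ true) else inp (bit_cell _ false)) ++
  index_body i ++ [:: true] ++ index_word i.+1 ++ code_cop (Some Rinc) l ++ index_body i)).
  apply: emit_cat; first by apply: emit_if; apply: emit_const.
  apply: emit_cat; first exact: emit_index_body.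
  apply: emit_cat; first exact: emit_const.
  apply: emit_cat; first exact: emit_index_succ.
  by apply: emit_cat; [exact: emit_cop | exact: emit_index_body].
move=> w i l lt _; rewrite /index_body -!(@index_wordE w) ?(ltnW lt) //.
have assoc (a b e f : word) :
    (true :: a ++ b) ++ (true :: e ++ f) ++ [::] = (true :: a) ++ b ++ [:: true] ++ e ++ f.
  by rewrite cats0 /= -catA.
have -> : (if nth false w i then inp (bit_cell _ true) else inp (bit_cell _ false)) =
    true :: code_nat (@index w (inl (KInput (bit_cell _ (nth false w i))))) by case: nth.
exact: (assoc _ (code_nat 0 ++ code_nat (@index w (inr (inord i)))) (code_nat (@index w (inr (inord i.+1))))).
Qed.

(** The input head is on the right blank, so its position [i] supplies the index [size w]. *)
Lemma emit_end_rules bl : emits_for false bl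
  (fun w i l => flatten [seq code_rule (@index w) l r | r <- end_rules M w]).
Proof.
pose inp x : word := true :: code_nat (enum_rank (KInput x : kind M)).
apply: (@emit_ext _ _ _ _ (fun w i l =>
  (true :: index_word 0 ++ code_nat 2 ++ code_nat 0 ++ inp None) ++
  index_body i ++ [:: true] ++ index_word i ++ code_cop (Some Rinc) l ++ index_body i)).
  apply: emit_cat; first exact: emit_const.
  apply: emit_cat; first exact: emit_index_body.
  apply: emit_cat; first exact: emit_const.
  apply: emit_cat; first exact: emit_index.
  by apply: emit_cat; [exact: emit_cop | exact: emit_index_body].
move=> w i l /eqP-> _; rewrite /index_body -!(@index_wordE w) //.
have assoc (a z p b e f : word) : (true :: a ++ z) ++ (p ++ b) ++ (true :: e ++ f) ++ [::] =
    (true :: a ++ z ++ p) ++ b ++ [:: true] ++ e ++ f.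
  by rewrite cats0 /= -!catA.
exact: (assoc (code_nat (@index w (inr (inord 0)))) (code_nat 2 ++ code_nat 0) (inp None)
  (code_nat 0 ++ code_nat (@index w (inr (inord (size w))))) (code_nat (@index w (inr (inord (size w)))))).
Qed.

Lemma emit_program : emits_for false true
  (fun w _ l => flatten [seq code_rule (@index w) l r | r <- program M w]).
Proof.
apply: (@emit_ext _ _ _ _ (fun w i l =>
  flatten [seq machine_rule_word r l | r <- machine_rules M] ++
  flatten [seq flatten [seq code_rule (@index w) l r | r <- letter_rules M w i] | i <- iota 0 (size w)] ++
  flatten [seq code_rule (@index w) l r | r <- end_rules M w])).
  apply: emit_cat; first by apply: emit_all => r; apply: emit_machine_rule.
  apply: emit_cat; last exact: emit_end_rules.
  exact: emit_loop_in (emit_letter_rules true).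
move=> w i l _ _; rewrite map_cat flatten_cat; congr (_ ++ _).
  rewrite -map_comp; congr (flatten _); apply: eq_map => -[[x o] b].
  by rewrite /machine_rule_word -(code_body_kind w).
rewrite map_cat flatten_cat; congr (_ ++ _).
exact: flatten_map_flatten.
Qed.

Lemma emit_structures : emits_for false false (fun w _ _ =>
  flatten [seq (true :: code_structure (automaton (size_m w) true l)) ++
               (true :: code_structure (automaton (size_m w) false l)) | l <- iota 0 (size_m w)]).
Proof.
apply: (@emit_loop_X _ _ false (fun w _ l => (true :: code_structure (automaton (size_m w) true l)) ++
               (true :: code_structure (automaton (size_m w) false l)))).
have one b : emits_for false true (fun w _ l => true :: code_structure (automaton (size_m w) b l)).
  apply: (@emit_ext _ _ _ _ (fun w _ l => [:: true] ++ rel_table ++ base_tables b ++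
    flatten (nseq l (cop_table b true false)) ++
    cop_table b false false ++ flatten (nseq (size_m w - l.+1) (cop_table b false true)))).
    do 3 (apply: emit_cat; first exact: emit_const).
    apply: emit_cat; first exact: emit_before_X.
    apply: emit_cat; first exact: emit_const.
    exact: emit_after_X.
  by move=> w i l _ lm; rewrite code_automaton.
exact: emit_cat (one true) (one false).
Qed.

Lemma reduction_polytime : polytime (fun w => code_instance (reduction w)).
Proof.
apply: (@emittable_polytime c.*2.+1 d).
apply: emit_ext; last by move=> w i l _ _; rewrite code_datalog_instance.
apply: emit_cat; first exact: emit_const.
apply: emit_cat; first exact: emit_full_X.
apply: emit_cat; first exact: emit_const.
apply: emit_cat; first exact: emit_structures.
apply: emit_cat; first exact: emit_const.
apply: emit_cat.
  (* The number of nonterminals is [kappa + (size w).+1], one above the index printed at the right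
     blank. *)
  apply: (emit_ext (emit_index_succ false false)) => w i l /eqP-> _.
  by rewrite code_nat_add.
apply: emit_cat.
  exact: (@emit_const _ _ _ _ (code_nat (enum_rank (KAxiom M)) ++ true :: code_nat (enum_rank (KAxiom M)) ++
    code_nat 1 ++ code_nat 0 ++ code_nat 0 ++ code_nat (enum_rank (KAccept M)))).
apply: emit_cat; last exact: emit_const.
exact: emit_loop_X emit_program.
Qed.
End Reduction.

Theorem theorem8p1 (k : nat) (hk : 4 < k) :
  EXPTIME_hard (separator_realizability k).
Proof.
move=> L [M [c [d dec]]].
exists (fun w => code_instance (reduction k M c d w)).
split; first exact: reduction_polytime.
move=> w; rewrite (reduction_correct k dec); split.
  by move=> r; exists (reduction k M c d w).
(* The language only provides some instance with this code; injectivity identifies it with the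
   constructed one. *)
by move=> [I [/code_instance_inj<- r]].
Qed.
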